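(* Let $\Delta$ and $\Lambda$ be countable distance value sets. The following are equivalent: (i) $\mathrm{Iso}(\mathbb{U}_\Delta)$ and $\mathrm{Iso}(\mathbb{U}_\Lambda)$ are isomorphic as abstract groups; (ii) $\mathrm{Iso}(\mathbb{U}_\Delta)$ and $\mathrm{Iso}(\mathbb{U}_\Lambda)$ are isomorphic as topological groups; (iii) $\Delta$ and $\Lambda$ are equivalent.
   Context: A distance value set is a set $\Delta$ of positive real numbers such that for all $x,y\in\Delta$, $\min\{x+y,\sup\Delta\}\in\Delta$. A $\Delta$-metric space is a metric space all of whose nonzero distances lie in $\Delta$. For countable $\Delta$, $\mathbb{U}_\Delta$ denotes the Fraïssé limit of the class of finite $\Delta$-metric spaces: the unique (up to isometry) countable ultrahomogeneous $\Delta$-metric space into which every finite $\Delta$-metric space embeds isometrically. $\mathrm{Iso}(X)$ is the group of surjective isometries of $X$ with the topology of pointwise convergence in the metric. A triple $(x,y,z)$ of positive reals is a $\Delta$-triangle if $x,y,z\in\Delta$ and $|x-y|\le z\le x+y$. Distance value sets $\Delta,\Lambda$ are equivalent if there is a bijection $f:\Delta\to\Lambda$ such that for all positive reals $x,y,z$, $(x,y,z)$ is a $\Delta$-triangle iff $(f(x),f(y),f(z))$ is a $\Lambda$-triangle. *)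

(* Defs.v *)
From HB Require Import structures.
From mathcomp Require Import all_boot all_order all_algebra.
From mathcomp Require Import all_classical all_reals all_analysis.

Set Implicit Arguments.
Unset Strict Implicit.
Unset Printing Implicit Defensive.

Import Order.TTheory GRing.Theory Num.Theory.

Local Open Scope classical_set_scope.
Local Open Scope ring_scope.

(* The supremum is taken in the extended reals: [ereal_sup] is +oo when
   [Delta] is unbounded, whereas the real-valued [sup] would be 0. *)
Definition distance_value_set (R : realType) (Delta : set R) : Prop :=
  (forall x, Delta x -> 0 < x) /\
  (forall x y, Delta x -> Delta y ->
     (EFin @` Delta)
       (Order.min (x + y)%:E (ereal_sup (EFin @` Delta)))).

Definition Delta_triangle (R : realType) (Delta : set R) (x y z : R) : Prop :=
  [/\ Delta x, Delta y, Delta z & `|x - y| <= z <= x + y].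

(* [f] is only meaningful on [Delta], hence the restriction of [x], [y], [z];
   its values outside [Delta] are irrelevant. *)
Definition equivalent_value_sets (R : realType) (Delta Lambda : set R) : Prop :=
  exists2 f : R -> R, set_bij Delta Lambda f &
    forall x y z, Delta x -> Delta y -> Delta z ->
      (Delta_triangle Delta x y z <-> Delta_triangle Lambda (f x) (f y) (f z)).

Definition Delta_metric (R : realType) (Delta : set R) (X : metricType R) :
    Prop :=
  forall x y : X, x != y -> Delta (mdist x y).

Definition isometry (R : realType) (X Y : metricType R) (f : X -> Y) : Prop :=
  forall x y, mdist (f x) (f y) = mdist x y.

Record Iso (R : realType) (X : metricType R) := MkIso {
  Iso_fun :> X -> X ;
  Iso_isometry : isometry Iso_fun ;
  Iso_surj : forall y, exists x, Iso_fun x = y }.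

Section IsoGroup.
Context (R : realType) (X : metricType R).
Implicit Types g h : Iso X.

Lemma Iso_eq g h : (forall x, g x = h x) -> g = h.
Proof.
case: g h => [g gi gs] [h hi hs] /= gh.
have {}gh : g = h by apply/funext.
by subst h; congr MkIso; exact: Prop_irrelevance.
Qed.

Lemma Iso_inj g : injective g.
Proof.
move=> x y gxy; apply: (@mdist_positivity R).
by rewrite -(Iso_isometry g) gxy mdistxx.
Qed.

Definition Iso_one : Iso X :=
  @MkIso R X id (fun x y => erefl) (fun y => ex_intro _ y erefl).

Lemma Iso_mul_isometry g h : isometry (g \o h).
Proof. by move=> x y /=; rewrite !Iso_isometry. Qed.

Lemma Iso_mul_surj g h (y : X) : exists x, (g \o h) x = y.
Proof.
have [z <-] := Iso_surj g y; have [x <-] := Iso_surj h z.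
by exists x.
Qed.

Definition Iso_mul g h : Iso X :=
  MkIso (@Iso_mul_isometry g h) (@Iso_mul_surj g h).

Definition Iso_inv_fun g (y : X) : X := sval (cid (Iso_surj g y)).

Lemma Iso_inv_funK g : cancel (Iso_inv_fun g) g.
Proof. by move=> y; rewrite /Iso_inv_fun; case: cid. Qed.

Lemma Iso_funK g : cancel g (Iso_inv_fun g).
Proof. by move=> x; apply: (@Iso_inj g); rewrite Iso_inv_funK. Qed.

Lemma Iso_inv_isometry g : isometry (Iso_inv_fun g).
Proof. by move=> x y; rewrite -(Iso_isometry g) !Iso_inv_funK. Qed.

Lemma Iso_inv_surj g (y : X) : exists x, Iso_inv_fun g x = y.
Proof. by exists (g y); rewrite Iso_funK. Qed.

Definition Iso_inv g : Iso X :=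
  MkIso (@Iso_inv_isometry g) (@Iso_inv_surj g).

Lemma Iso_mulA : associative Iso_mul.
Proof. by move=> f g h; exact: Iso_eq. Qed.

Lemma Iso_mul1g : left_id Iso_one Iso_mul.
Proof. by move=> g; exact: Iso_eq. Qed.

Lemma Iso_mulg1 : right_id Iso_one Iso_mul.
Proof. by move=> g; exact: Iso_eq. Qed.

Lemma Iso_mulVg : left_inverse Iso_one Iso_inv Iso_mul.
Proof. by move=> g; apply: Iso_eq => x /=; rewrite Iso_funK. Qed.

Lemma Iso_mulgV : right_inverse Iso_one Iso_inv Iso_mul.
Proof. by move=> g; apply: Iso_eq => x /=; rewrite Iso_inv_funK. Qed.

HB.instance Definition _ := gen_eqMixin (Iso X).
HB.instance Definition _ := gen_choiceMixin (Iso X).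
HB.instance Definition _ := isGroup.Build (Iso X)
  Iso_mulA Iso_mul1g Iso_mulg1 Iso_mulVg Iso_mulgV.

(* Pointwise convergence for the topology that the metric induces on [X]: the
   subspace topology inherited from the product space [{ptws X -> X}]. *)
Definition Iso_ptws (g : Iso X) : {ptws X -> X} := g.

HB.instance Definition _ :=
  Topological.copy (Iso X) (initial_topology Iso_ptws).

End IsoGroup.

Definition ultrahomogeneous (R : realType) (X : metricType R) : Prop :=
  forall (A : set X) (f : X -> X), finite_set A ->
    (forall x y, A x -> A y -> mdist (f x) (f y) = mdist x y) ->
    exists g : Iso X, forall x, A x -> g x = f x.

(* [X] is (an isometric copy of) the Fraisse limit of the class of finite
   [Delta]-metric spaces. *)
Definition urysohn_space (R : realType) (Delta : set R) (X : metricType R) :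
    Prop :=
  [/\ countable [set: X],
      Delta_metric Delta X,
      ultrahomogeneous X
    & forall F : metricType R, finite_set [set: F] -> Delta_metric Delta F ->
        exists e : F -> X, isometry e].

Definition group_isomorphic (G H : groupType) : Prop :=
  exists f : {multiplicative G -> H}, bijective f.

Definition Iso_topologically_isomorphic (R : realType) (X Y : metricType R) :
    Prop :=
  exists (f : {multiplicative Iso X -> Iso Y}) (f' : Iso Y -> Iso X),
    [/\ cancel f f', cancel f' f, continuous f & continuous f'].

(* Main.v *)
Require Import Defs.
From HB Require Import structures.
From mathcomp Require Import all_boot all_order all_algebra.
From mathcomp Require Import all_classical all_reals all_analysis.
From mathcomp Require Import lra.

Set Implicit Arguments.
Unset Strict Implicit.
Unset Printing Implicit Defensive.

Import Order.TTheory GRing.Theory Num.Theory.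

Local Open Scope classical_set_scope.
Local Open Scope ring_scope.

(* The implications (iii) => (ii) => (i) are soft: an equivalence f of value
   sets turns a back-and-forth argument into a bijection b of the two Urysohn
   spaces with d(b x, b y) = f(d(x, y)), and b is a homeomorphism because
   x <= 2y iff f x <= 2 f y, so f tends to 0 at 0.

   For (i) => (iii) let G = Iso(U), with the permutation topology in which the
   pointwise stabilizers of finite sets are the basic open subgroups.
   - The supports of a subgroup K (the finite A whose pointwise stabilizer lies
     in K) are closed under intersection. Hence point stabilizers are maximal,
     a proper open subgroup leaves a nonempty finite set invariant, and an open
     normal subgroup of G_x is G_x. So an isomorphism G -> G' under which the
     images of point stabilizers are open in both directions maps point
     stabilizers to point stabilizers; the induced bijection of the spaces
     carries the orbits of pairs, i.e. the distances, to each other and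
     preserves triangles.
   - Openness is automatic because G_x = C(tau) C(sigma) C(tau) for two
     involutions tau and sigma: the image of G_x is then a product of three
     closed sets, of countable index, and a category argument makes it open.
   - For this decomposition, tau and sigma form a generic pair of involutions
     fixing only x. By back and forth, two generic pairs are conjugate. Given
     g in G_x, some conjugate sigma' of sigma is generic both with tau and with
     g tau g^-1, and the two conjugacies exhibit g as such a product. Generic
     pairs exist because a finite space with a total and a partial isometric
     involution extends to a finite space on which both are total. *)

(** * Truncated values and finite pseudometrics *)

(** An abstract isomorphism carries no topological information, so openness has to be recovered from
    algebra. Centralizers suit this: isomorphisms map them to centralizers, and they are closed, so
    category arguments apply to their products. As tau and sigma fix only x, every element of their
    centralizers fixes x. The three factors arise from changing one member of the pair (tau, sigma)
    at a time. The finite constructions share one obstacle: sums of values may leave the value set,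
    and only sums capped at its supremum stay inside. Distances are therefore computed as plain path
    lengths and capped at the very end. Pseudometrics allow points to be glued by giving them
    distance 0. The delicate construction is the one that makes a partial involution total. The
    product of the two involutions is a partial translation, whose orbits need not close up in a
    finite set; the resulting line of copies must be bent into a cycle without shortening any
    distance and without new fixed points. *)

Section Truncation.
Context (R : realType) (D : set R).
Hypothesis hD : distance_value_set D.

(* Useful only for nonempty D: [ereal_sup] of the empty set is -oo. *)
Definition vtrunc (v : R) : R :=
  fine (Order.min v%:E (ereal_sup (EFin @` D))).

(** The supremum of a nonempty [D] is a real [M] or +oo, so truncation is either capping at [M] or
    the identity. Later facts on [vtrunc] go through this dichotomy. *)
Lemma vtrunc_cases (r0 : R) : D r0 ->
  (exists M, [/\ 0 < M, forall u, D u -> u <= M &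
     forall v, vtrunc v = Order.min v M]) \/
  (forall v, vtrunc v = v).
Proof.
move=> Dr0; have ub u : D u -> (u%:E <= ereal_sup (EFin @` D))%E.
  by move=> Du; apply: ereal_sup_ubound; exists u.
rewrite /vtrunc; case: (ereal_sup _) ub => [M||] ub.
- left; exists M; split => [|u /ub//|v]; last by rewrite -EFin_min.
  by have := ub _ Dr0; rewrite lee_fin; apply: lt_le_trans; apply: hD.1.
- by right=> v; rewrite minEle leey.
- by have := ub _ Dr0; rewrite leeNy_eq.
Qed.

Lemma vtruncE (v : R) : D v -> vtrunc v = v.
Proof.
move=> Dv; have [[M [_ ub ->]]|//] := vtrunc_cases Dv.
by rewrite minEle ub.
Qed.

Lemma vtruncDr (x y : R) : D x -> D y -> D (vtrunc (x + y)).
Proof. by move=> Dx Dy; have [z Dz] := hD.2 _ _ Dx Dy; rewrite /vtrunc => <-. Qed.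

(** The lengths of paths with steps in [D]: such a sum may lie outside [D], but its truncation does
    not. *)
Definition admissible (v : R) : Prop := v = 0 \/ 0 < v /\ D (vtrunc v).

Lemma admissible_ge0 v : admissible v -> 0 <= v.
Proof. by case=> [->|[/ltW]]. Qed.

(** Capping the summands first does not change the capped sum: min(min(x, M) + min(y, M), M) = min(x
    + y, M) for x, y > 0. *)
Lemma admissibleD x y : admissible x -> admissible y -> admissible (x + y).
Proof.
case=> [->|[x0 Dx]]; first by rewrite add0r.
case=> [->|[y0 Dy]]; first by rewrite addr0; right.
right; split; first exact: addr_gt0.
have := vtruncDr Dx Dy.
have [[M [M0 ub E]]|E] := vtrunc_cases Dx; last by rewrite !E.
rewrite !E !minEle.
by case: (leP x M) => ?; case: (leP y M) => ?; do ?[case: leP => ?] => // Dz;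
  exfalso; lra.
Qed.

(** Distinct indices may be at distance 0; the quotient is taken only when a pseudometric is
    realized in [U]. *)
Definition pmet (J : Type) (rho : J -> J -> R) : Prop :=
  [/\ forall x, rho x x = 0, forall x y, rho x y = rho y x &
      forall x y z, rho x z <= rho x y + rho y z].

Definition valued (J : Type) (rho : J -> J -> R) : Prop :=
  forall x y, rho x y = 0 \/ D (rho x y).

Lemma pmet_ge0 (J : Type) (rho : J -> J -> R) x y : pmet rho -> 0 <= rho x y.
Proof.
case=> r0 rs rt; have := rt x y x; rewrite r0 (rs y x); lra.
Qed.

Lemma valued_admissible (J : Type) (rho : J -> J -> R) x y :
  valued rho -> admissible (rho x y).
Proof.
move=> v; case: (v x y) => [|Dr]; first by left.
by right; split; [exact: hD.1|rewrite vtruncE].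
Qed.

Lemma vtrunc_pmet (r0 : R) (J : Type) (rho : J -> J -> R) : D r0 -> pmet rho ->
  pmet (fun x y => vtrunc (rho x y)).
Proof.
move=> Dr0 hr; have hp x y := pmet_ge0 x y hr; case: hr => h0 hs ht.
have [[M [M0 ub E]]|E] := vtrunc_cases Dr0; split => [x|x y|x y z]; rewrite ?E ?h0 //.
- by rewrite minEle (ltW M0).
- by rewrite hs.
- rewrite !minEle; have := ht x y z; have := hp x y; have := hp y z.
  by case: (leP (rho x z) M) => ?; case: (leP (rho x y) M) => ?;
    case: (leP (rho y z) M) => ?; lra.
Qed.

Lemma vtrunc_valued (J : Type) (rho : J -> J -> R) :
  (forall x y, admissible (rho x y)) -> (exists r, D r) ->
  valued (fun x y => vtrunc (rho x y)).
Proof.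
move=> ha [r Dr] x y; case: (ha x y) => [->|[_]]; last by right.
left; have [[M [M0 ub ->]]|//] := vtrunc_cases Dr.
by rewrite minEle (ltW M0).
Qed.

Lemma vtrunc_eq0 (r0 v : R) : D r0 -> 0 <= v -> vtrunc v = 0 -> v = 0.
Proof.
move=> Dr0 v0; have [[M [M0 ub ->]]|->//] := vtrunc_cases Dr0.
by rewrite minEle; case: ifP => // _ M00; rewrite M00 ltxx in M0.
Qed.

Lemma vtrunc0 (r0 : R) : D r0 -> vtrunc 0 = 0.
Proof.
move=> Dr0; have [[M [M0 ub ->]]|->//] := vtrunc_cases Dr0.
by rewrite minEle (ltW M0).
Qed.

Lemma vtrunc_val (v : R) (r0 : R) : D r0 -> v = 0 \/ D v -> vtrunc v = v.
Proof. by move=> Dr0 [->|/vtruncE//]; exact: vtrunc0 Dr0. Qed.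

End Truncation.

Section MetricQuotient.
Context (R : realType) (J : finType) (rho : J -> J -> R).
Hypothesis hr : pmet rho.

Definition mrep (j : J) : J := odflt j [pick k | rho j k == 0].

Lemma rho_mrep j : rho j (mrep j) = 0.
Proof.
rewrite /mrep; case: pickP => [k /eqP//|/(_ j)].
by case: hr => ->; rewrite eqxx.
Qed.

Lemma rho_congr a b c : rho a b = 0 -> rho a c = rho b c.
Proof.
case: hr => h0 hs ht ab; apply/eqP; rewrite eq_le.
have := ht a b c; have := ht b a c; rewrite (hs b a) ab !add0r.
by move=> -> ->.
Qed.

Lemma mrep_eq a b : rho a b = 0 -> mrep a = mrep b.
Proof.
move=> ab; rewrite /mrep.
rewrite (_ : [pick k | rho a k == 0] = [pick k | rho b k == 0]); last first.
  by apply: eq_pick => k; rewrite /= (rho_congr _ ab).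
case: pickP => // /(_ b); case: hr => ->; by rewrite eqxx.
Qed.

(* Points at distance 0 are identified by keeping one representative of each
   class. The proof argument lets the metric structure be inferred. *)
Definition mquot of pmet rho := {j : J | mrep j == j}.

Lemma mrep_id j : mrep (mrep j) == mrep j.
Proof. by apply/eqP/esym/mrep_eq/rho_mrep. Qed.

Definition mcls (j : J) : mquot hr := exist _ (mrep j) (mrep_id j).

HB.instance Definition _ := Choice.copy (mquot hr) {j : J | mrep j == j}.

Let mq (a b : mquot hr) : R := rho (val a) (val b).

Let mqxx a : mq a a = 0. Proof. by case: hr => + _ _; exact. Qed.
Let mq_pos a b : mq a b = 0 -> a = b.
Proof.
move=> ab; apply: val_inj.
by rewrite -(eqP (valP a)) -(eqP (valP b)); exact: mrep_eq.
Qed.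
Let mq_sym a b : mq a b = mq b a. Proof. by case: hr => _ + _; exact. Qed.
Let mq_tri b a c : mq a c <= mq a b + mq b c. Proof. by case: hr => _ _; exact. Qed.

HB.instance Definition _ :=
  isMetric.Build R (mquot hr) mqxx mq_pos mq_sym mq_tri.

Lemma mdist_mcls i j : mdist (mcls i) (mcls j) = rho i j.
Proof.
rewrite /mdist /= /mq /= -(rho_congr _ (rho_mrep i)).
case: hr => _ hs _; rewrite hs (hs i); symmetry.
exact/rho_congr/rho_mrep.
Qed.

Lemma finite_mquot : finite_set [set: mquot hr].
Proof. exact: (@finite_finset {j : J | mrep j == j}). Qed.

End MetricQuotient.

Lemma lift_fun (J X Y : Type) (y0 : Y) (v : J -> X) (w : J -> Y) :
  (forall i j, v i = v j -> w i = w j) -> exists f, forall j, f (v j) = w j.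
Proof.
move=> vw; pose f x := if pselect (exists j, v j = x) is left p
  then w (sval (cid p)) else y0.
exists f => j; rewrite /f; case: pselect => [p|[]]; last by exists j.
by apply: vw; case: cid.
Qed.

(** * Extension properties and generic limits *)

Section UrysohnExtension.
Context (R : realType) (D : set R) (U : metricType R).
Hypotheses (hD : distance_value_set D) (hU : urysohn_space D U).

Lemma urysohn_valued : valued D (@mdist R U).
Proof.
move=> x y; have [->|xy] := eqVneq x y; first by left; rewrite mdistxx.
by right; case: hU => _ h _ _; apply: h.
Qed.

Lemma mdist_pmet : pmet (@mdist R U).
Proof.
split; [exact: mdistxx|exact: metric_sym|exact: metric_triangle].
Qed.

Lemma seq_pmet (F : seq U) :
  pmet (fun i j : seq_sub F => mdist (val i) (val j)).
Proof.
by case: mdist_pmet => p1 p2 p3; split => *; [exact: p1|exact: p2|exact: p3].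
Qed.

Lemma seq_valued (F : seq U) :
  valued D (fun i j : seq_sub F => mdist (val i) (val j)).
Proof. by move=> i j; exact: urysohn_valued. Qed.

Lemma partial_isometry_extends (J : finType) (v w : J -> U) :
  (forall i j, mdist (v i) (v j) = mdist (w i) (w j)) ->
  exists g : Iso U, forall j, g (v j) = w j.
Proof.
move=> vw; case: (pickP (@predT J)) => [j0 _|e]; last first.
  by exists (Iso_one U) => j; have := e j.
have [i j vij|f hf] := lift_fun (w j0) (v := v) (w := w).
  by apply: (@mdist_positivity R); rewrite -vw vij mdistxx.
case: hU => _ _ uh _; have [|_ _ [i _ <-] [j _ <-]|g hg] := uh (range v) f.
- exact: finite_image.
- by rewrite !hf vw.
- by exists g => j; rewrite hg ?hf //; exists j.
Qed.

(** Universality embeds the quotient of [J] somewhere in [U]; ultrahomogeneity then moves this copy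
    so that it agrees with [e0] on [J0]. *)
Lemma urysohn_extension (J : finType) (rho : J -> J -> R) (J0 : J -> Prop)
    (e0 : J -> U) : pmet rho -> valued D rho ->
  (forall i j, J0 i -> J0 j -> mdist (e0 i) (e0 j) = rho i j) ->
  exists e : J -> U, (forall i j, mdist (e i) (e j) = rho i j) /\
    (forall j, J0 j -> e j = e0 j).
Proof.
move=> hr hv h0; case: (hU) => _ _ _ univ.
have [||e1 he1] := univ (mquot hr).
- exact: finite_mquot.
- move=> x y /eqP xy; case: (hv (val x) (val y)) => // r0.
  by case: xy; exact: (@mdist_positivity R).
pose e2 j := e1 (mcls hr j).
have he2 i j : mdist (e2 i) (e2 j) = rho i j by rewrite he1 mdist_mcls.
case: (pselect (exists j0, J0 j0)) => [[j0 Jj0]|nJ]; last first.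
  by exists e2; split => // j Jj; case: nJ; exists j.
have [] := @partial_isometry_extends {j : J | `[< J0 j >]}
  (fun j => e2 (val j)) (fun j => e0 (val j)).
  by move=> [i hi] [j hj]; rewrite he2 h0 //; exact/asboolP.
move=> g hg; exists (fun j => g (e2 j)); split => [i j|j Jj].
  by rewrite Iso_isometry he2.
by rewrite (hg (exist _ j (introT (asboolP _) Jj))).
Qed.

(** The hypotheses make [f] a Katetov function on [F], so that one new point at distances [f] gives
    a finite space with values in [D]. For empty [F] any point will do, and a one-point space is
    embedded. *)
Lemma katetov_point (F : seq U) (f : U -> R) :
  {in F, forall x, D (f x)} ->
  {in F &, forall x y, f x <= f y + mdist x y} ->
  {in F &, forall x y, mdist x y <= f x + f y} ->
  exists w, {in F, forall x, mdist w x = f x}.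
Proof.
move=> fD fl fk; case: (pselect (exists x0, x0 \in F)) => [[x0 x0F]|nF]; last first.
  case: F fD fl fk nF => [_ _ _ _|x F _ _ _ []]; last by exists x; rewrite mem_head.
  case: hU => _ _ _ /(_ (mquot (_ : pmet (fun _ _ : unit => 0 : R)))).
  have h : pmet (fun _ _ : unit => 0 : R) by split => // *; rewrite addr0.
  move=> /(_ h) []; [exact: finite_mquot| |].
    by move=> [[] ?] [[] ?] /eqP[]; exact: val_inj.
  by move=> e _; exists (e (mcls h tt)).
have inF (x : seq_sub F) : ssval x \in F by exact: ssvalP.
pose J : finType := option (seq_sub F).
pose rho (i j : J) : R := match i, j with
  | None, None => 0 | None, Some x => f (val x) | Some x, None => f (val x)
  | Some x, Some y => mdist (val x) (val y) end.
have [|||e [he ee]] := @urysohn_extension J rho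
    (fun j => isSome j) (fun j => if j is Some x then val x else x0).
- split => [[x|]|[x|] [y|]|[x|] [y|] [z|]] //=; rewrite ?mdistxx ?addr0 ?add0r //.
  + exact: metric_sym.
  + exact: metric_triangle.
  + by rewrite addrC; exact: fl.
  + exact: fk.
  + by rewrite metric_sym; exact: fl.
  + by apply: addr_ge0; apply/ltW/hD.1/fD.
- move=> [x|] [y|] /=; [exact: urysohn_valued| | |by left];
    by right; apply: fD.
- by move=> [x|] [y|].
exists (e None) => x xF; pose x' : J := Some (SeqSub xF).
by have := he None x'; rewrite (ee x').
Qed.

Lemma urysohn_inhabited : exists _ : U, True.
Proof. by have [] := @katetov_point [::] (fun=> 0) => // w; exists w. Qed.

End UrysohnExtension.

Lemma countable_enum (X : Type) (x0 : X) : countable [set: X] ->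
  exists en : nat -> X, forall x, exists n, en n = x.
Proof.
move=> /pcard_leP/unsquash f.
pose en n := if pselect (exists x, f x = n) is left p then sval (cid p) else x0.
exists en => x; exists (f x); rewrite /en; case: pselect => [p|[]]; last by exists x.
by case: cid => y /= /(@inj _ _ _ f); apply; rewrite inE.
Qed.

(* A condition (E, g) stands for the finite partial map g restricted to E; the
   values of g outside E are irrelevant. *)
Section RasiowaSikorski.
Context (X : eqType) (Y : Type) (K : countType) (en : nat -> X).
Hypothesis enP : forall x, exists n, en n = x.
Context (P : seq X -> (X -> Y) -> Prop) (A : K -> seq X -> (X -> Y) -> Prop).

Definition refines (E : seq X) (g : X -> Y) (E' : seq X) (g' : X -> Y) : Prop :=
  {subset E <= E'} /\ {in E, g =1 g'}.

Hypothesis dom_dense : forall x E g, P E g ->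
  exists E' g', [/\ P E' g', refines E g E' g' & x \in E'].
Hypothesis dense : forall k E g, P E g ->
  exists E' g', [/\ P E' g', refines E g E' g' & A k E' g'].

Lemma refines_trans E g E1 g1 E2 g2 :
  refines E g E1 g1 -> refines E1 g1 E2 g2 -> refines E g E2 g2.
Proof.
move=> [s1 a1] [s2 a2]; split => [x /s1/s2//|x xE].
by rewrite a1 // a2 // s1.
Qed.

(** Stage n puts [en n] into the domain and then meets the requirement with code n; [h] is the union
    of the chain. The second conclusion lets [h] inherit every property of conditions that involves
    finitely many points. *)
Lemma generic_limit E0 g0 : P E0 g0 -> exists h : X -> Y,
  [/\ {in E0, h =1 g0},
      forall F : seq X, exists E g, [/\ P E g, {subset F <= E} & {in E, h =1 g}]
    & forall k, exists E g, [/\ P E g, A k E g & {in E, h =1 g}]].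
Proof.
move=> P0; pose St := {s : seq X * (X -> Y) | P s.1 s.2}.
have step (n : nat) (s : St) : exists s' : St,
    [/\ refines (sval s).1 (sval s).2 (sval s').1 (sval s').2, en n \in (sval s').1 &
     forall k : K, unpickle n = Some k -> exists E g,
       [/\ P E g, A k E g & refines E g (sval s').1 (sval s').2]].
  have [E1 [g1 [P1 r1 x1]]] := dom_dense (en n) (svalP s).
  case uk: (unpickle n) => [k|]; last first.
    by exists (exist _ (E1, g1) P1); split => // k; rewrite uk.
  have [E2 [g2 [P2 r2 A2]]] := dense k P1.
  exists (exist _ (E2, g2) P2); split => /=.
  - exact: refines_trans r1 r2.
  - by case: r2 => + _; apply.
  - by move=> _ [<-]; exists E2, g2; split => //; split.
have /choice[F hF] : forall ns : nat * St, exists s' : St, 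
    [/\ refines (sval ns.2).1 (sval ns.2).2 (sval s').1 (sval s').2, en ns.1 \in (sval s').1 &
     forall k : K, unpickle ns.1 = Some k -> exists E g,
       [/\ P E g, A k E g & refines E g (sval s').1 (sval s').2]].
  by move=> [n s]; exact: step.
pose fix s n : St := if n is m.+1 then F (m, s m) else exist _ (E0, g0) P0.
have mono m n : (m <= n)%N ->
    refines (sval (s m)).1 (sval (s m)).2 (sval (s n)).1 (sval (s n)).2.
  elim: n => [|n IH]; first by rewrite leqn0 => /eqP ->; split.
  rewrite leq_eqVlt => /orP[/eqP ->|]; first by split.
  rewrite ltnS => /IH r; apply: refines_trans r _.
  by case: (hF (n, s n)).
have cover x : exists n, x \in (sval (s n)).1.
  have [n <-] := enP x; exists n.+1; by case: (hF (n, s n)).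
pose lev x := sval (cid (cover x)).
pose h x := (sval (s (lev x))).2 x.
have hs n : {in (sval (s n)).1, h =1 (sval (s n)).2}.
  move=> x xn; rewrite /h /lev; case: cid => m /= xm.
  case: (leqP m n) => [/mono[_ a]|/ltnW/mono[_ a]]; first by rewrite a.
  by rewrite -a.
exists h; split.
- exact: (hs 0).
- move=> G; have [n hn] : exists n, {subset G <= (sval (s n)).1}.
    elim: G => [|y H [n hn]]; first by exists 0%N.
    have [m ym] := cover y; exists (maxn m n) => z; rewrite inE => /orP[/eqP ->|/hn].
      by case: (mono _ _ (leq_maxl m n)) => + _; apply.
    by case: (mono _ _ (leq_maxr m n)) => + _; apply.
  by exists (sval (s n)).1, (sval (s n)).2; split => //; exact: svalP (s n).
- move=> k; case: (hF (pickle k, s (pickle k))) => _ _ /(_ k (pickleK k)).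
  move=> [E [g [PE AE [r1 r2]]]]; exists E, g; split => // x xE.
  by rewrite (hs (pickle k).+1) ?r2 // r1.
Qed.

End RasiowaSikorski.

Section GenericIsometry.
Context (R : realType) (U : metricType R) (K : countType) (x0 : U).
Hypothesis cU : countable [set: U].
Context (P : seq U -> Iso U -> Prop) (A : K -> seq U -> Iso U -> Prop).

Hypothesis dom_dense : forall x E (g : Iso U), P E g ->
  exists E' (g' : Iso U), [/\ P E' g', refines E g E' g' & x \in E'].
Hypothesis ran_dense : forall y E (g : Iso U), P E g ->
  exists E' (g' : Iso U), [/\ P E' g', refines E g E' g' & y \in map g' E'].
Hypothesis dense : forall k E (g : Iso U), P E g ->
  exists E' (g' : Iso U), [/\ P E' g', refines E g E' g' & A k E' g'].

(** Conditions are restrictions of global isometries, which costs nothing in an ultrahomogeneous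
    space. Surjectivity of the limit is imposed by the additional requirements [inl n]. *)
Lemma generic_isometry E0 (g0 : Iso U) : P E0 g0 -> exists h : Iso U,
  [/\ {in E0, h =1 g0},
      forall F : seq U, exists E (g : Iso U),
        [/\ P E g, {subset F <= E} & {in E, h =1 g}]
    & forall k, exists E (g : Iso U), [/\ P E g, A k E g & {in E, h =1 g}]].
Proof.
move=> P0; have [en enP] := countable_enum x0 cU.
pose P' E (f : U -> U) := exists2 g : Iso U, P E g & f = g :> (U -> U).
pose A' (k : nat + K) E (f : U -> U) : Prop := match k with
  | inl n => en n \in map f E
  | inr k => exists2 g : Iso U, P E g /\ A k E g & f = g :> (U -> U) end.
have [|||h [h0 hF hA]] := @generic_limit U U (nat + K)%type en enP P' A' _ _ E0 g0.
- move=> x E _ [g Pg ->]; have [E' [g' [P1 r1 xE]]] := dom_dense x Pg.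
  by exists E', g'; split => //; exists g'.
- move=> [n|k] E _ [g Pg ->].
    have [E' [g' [P1 r1 xE]]] := ran_dense (en n) Pg.
    by exists E', g'; split => //; exists g'.
  have [E' [g' [P1 r1 AE]]] := dense k Pg.
  by exists E', g'; split => //; exists g'.
- by exists g0.
have hi : Defs.isometry h.
  move=> x y; have [E [_ [[g _ ->] sE hE]]] := hF [:: x; y].
  by rewrite !hE ?Iso_isometry // sE // !inE eqxx ?orbT.
have hs y : exists x, h x = y.
  have [n <-] := enP y; have [E [f [_ /= /mapP[x xE ->] hE]]] := hA (inl n).
  by exists x; rewrite hE.
exists (MkIso hi hs); split => //.
- by move=> F; have [E [_ [[g Pg ->] sE hE]]] := hF F; exists E, g.
- move=> k; have [E [f [_ [g [Pg Ag] fg] hE]]] := hA (inr k).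
  by exists E, g; split => // x xE; rewrite -fg; exact: hE.
Qed.

End GenericIsometry.

(** * Free amalgams of finite pseudometrics *)

Section FiniteMin.
Context (R : realType) (K : finType) (P : pred K) (k0 : K) (F : K -> R).
Hypothesis Pk0 : P k0.

Definition minf : R := F [arg min_(k < k0 | P k) F k]%O.

Lemma minf_le k : P k -> minf <= F k.
Proof. by move=> Pk; rewrite /minf; case: arg_minP => // i Pi; exact. Qed.

Lemma minf_ex : exists2 k, P k & minf = F k.
Proof. by rewrite /minf; case: arg_minP => // i Pi _; exists i. Qed.

End FiniteMin.

Section Amalgam.
Context (R : realType) (D : set R) (r0 : R).
Hypotheses (hD : distance_value_set D) (Dr0 : D r0).
Context (J1 J2 K : finType) (rho1 : J1 -> J1 -> R) (rho2 : J2 -> J2 -> R).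
Hypotheses (h1 : pmet rho1) (h2 : pmet rho2).
Hypotheses (v1 : valued D rho1) (v2 : valued D rho2).
Context (i1 : K -> J1) (i2 : K -> J2) (k0 : K).
Hypothesis h12 : forall a b, rho1 (i1 a) (i1 b) = rho2 (i2 a) (i2 b).

(** The shortest path between the two sides, which has to pass through the common part [K]; [k0]
    makes the minimum range over a nonempty set. *)
Let cross p q := minf xpredT k0 (fun a => rho1 p (i1 a) + rho2 (i2 a) q).

Let raw (x y : J1 + J2) : R := match x, y with
  | inl p, inl q => rho1 p q | inr p, inr q => rho2 p q
  | inl p, inr q => cross p q | inr q, inl p => cross p q end.

Let cross_le p q a : cross p q <= rho1 p (i1 a) + rho2 (i2 a) q.
Proof.
exact: (@minf_le R K xpredT k0 (fun a => rho1 p (i1 a) + rho2 (i2 a) q) isT a isT).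
Qed.

Let cross_ex p q : exists a, cross p q = rho1 p (i1 a) + rho2 (i2 a) q.
Proof.
have [a _ h] := @minf_ex R K xpredT k0 (fun a => rho1 p (i1 a) + rho2 (i2 a) q) isT.
by exists a.
Qed.

Let raw_pmet : pmet raw.
Proof.
have r1 := pmet_ge0 _ _ h1; have r2 := pmet_ge0 _ _ h2.
case: (h1) => z1 s1 t1; case: (h2) => z2 s2 t2.
split => [[p|p]|[p|p] [q|q]|[p|p] [q|q] [r|r]] //=.
- have [a ->] := cross_ex q r; have := cross_le p r a; have := t1 p q (i1 a); lra.
- have [a ->] := cross_ex p q; have [b ->] := cross_ex r q.
  have := t1 p (i1 a) r; have := t1 (i1 a) (i1 b) r.
  rewrite (h12 a b) (s1 (i1 b) r); have := t2 (i2 a) q (i2 b); rewrite (s2 q); lra.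
- have [a ->] := cross_ex p q; have := cross_le p r a; have := t2 (i2 a) q r; lra.
- have [a ->] := cross_ex q p; have := cross_le r p a; have := t1 r q (i1 a).
  rewrite (s1 r q); lra.
- have [a ->] := cross_ex q p; have [b ->] := cross_ex q r.
  have := t2 p (i2 a) r; have := t2 (i2 a) (i2 b) r.
  rewrite -(h12 a b) (s2 p (i2 a)); have := t1 (i1 a) q (i1 b); rewrite (s1 _ q); lra.
- have [a ->] := cross_ex r q; have := cross_le r p a; have := t2 (i2 a) q p.
  rewrite (s2 q p); lra.
Qed.

Let raw_adm x y : admissible D (raw x y).
Proof.
case: x y => [p|p] [q|q] /=; try exact: valued_admissible.
- have [a ->] := cross_ex p q; apply: admissibleD => //; exact: valued_admissible.
- have [a ->] := cross_ex q p; apply: admissibleD => //; exact: valued_admissible.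
Qed.

Definition amalgam (x y : J1 + J2) : R := vtrunc D (raw x y).

Lemma amalgam_pmet : pmet amalgam.
Proof. exact: (vtrunc_pmet hD Dr0 raw_pmet). Qed.

Lemma amalgam_valued : valued D amalgam.
Proof. by apply: vtrunc_valued => //; exists r0. Qed.

Lemma amalgam_inl p q : amalgam (inl p) (inl q) = rho1 p q.
Proof. exact: (vtrunc_val hD Dr0 (v1 p q)). Qed.

Lemma amalgam_inr p q : amalgam (inr p) (inr q) = rho2 p q.
Proof. exact: (vtrunc_val hD Dr0 (v2 p q)). Qed.

Lemma amalgam_glue a : amalgam (inl (i1 a)) (inr (i2 a)) = 0.
Proof.
have c0 : cross (i1 a) (i2 a) = 0.
  apply/eqP; rewrite eq_le (pmet_ge0 (inl (i1 a)) (inr (i2 a)) raw_pmet) andbT.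
  have := cross_le (i1 a) (i2 a) a; case: (h1) => -> _ _; case: (h2) => -> _ _.
  by rewrite addr0.
by rewrite /amalgam /= c0 (vtrunc0 hD Dr0).
Qed.

Lemma amalgam_eq0 p q : amalgam (inl p) (inr q) = 0 ->
  exists a, rho1 p (i1 a) = 0 /\ rho2 (i2 a) q = 0.
Proof.
move/(vtrunc_eq0 hD Dr0 (pmet_ge0 (inl p) (inr q) raw_pmet)) => /=.
have [a ->] := cross_ex p q; exists a.
have := pmet_ge0 p (i1 a) h1; have := pmet_ge0 (i2 a) q h2; lra.
Qed.

Definition sum_map (t1 : J1 -> J1) (t2 : J2 -> J2) (x : J1 + J2) : J1 + J2 :=
  match x with inl p => inl (t1 p) | inr q => inr (t2 q) end.

(** By the last hypothesis the two involutions agree on glued points, up to distance 0. Hence they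
    carry crossing paths to crossing paths, so cross distances do not grow; applying the involutions
    once more gives equality. *)
Lemma sum_map_isometry (t1 : J1 -> J1) (t2 : J2 -> J2) :
  involutive t1 -> involutive t2 ->
  (forall p q, rho1 (t1 p) (t1 q) = rho1 p q) ->
  (forall p q, rho2 (t2 p) (t2 q) = rho2 p q) ->
  (forall a, exists b, rho1 (t1 (i1 a)) (i1 b) = 0 /\ rho2 (t2 (i2 a)) (i2 b) = 0) ->
  forall x y, amalgam (sum_map t1 t2 x) (sum_map t1 t2 y) = amalgam x y.
Proof.
move=> k1 k2 m1 m2 hc.
have le p q : cross (t1 p) (t2 q) <= cross p q.
  have [a ->] := cross_ex p q; have [b [b1 b2]] := hc a.
  apply: (le_trans (cross_le _ _ b)).
  case: (h1) => _ s1 _; case: (h2) => _ s2 _.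
  rewrite s1 -(rho_congr h1 _ b1) m1 s1 lerD2l.
  by rewrite -(rho_congr h2 _ b2) m2.
have eq p q : cross (t1 p) (t2 q) = cross p q.
  apply/eqP; rewrite eq_le le /=; have := le (t1 p) (t2 q); by rewrite k1 k2.
by move=> [p|p] [q|q]; rewrite /amalgam /= ?m1 ?m2 ?eq.
Qed.

Lemma sum_map_involutive t1 t2 : involutive t1 -> involutive t2 ->
  involutive (sum_map t1 t2).
Proof. by move=> k1 k2 [p|q] /=; rewrite ?k1 ?k2. Qed.

Lemma amalgamation : exists rho : (J1 + J2)%type -> (J1 + J2)%type -> R,
  [/\ pmet rho, valued D rho, forall p q, rho (inl p) (inl q) = rho1 p q,
      forall p q, rho (inr p) (inr q) = rho2 p q
    & forall a, rho (inl (i1 a)) (inr (i2 a)) = 0] /\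
  (forall p q, rho (inl p) (inr q) = 0 ->
     exists a, rho1 p (i1 a) = 0 /\ rho2 (i2 a) q = 0) /\
  (forall (t1 : J1 -> J1) (t2 : J2 -> J2), involutive t1 -> involutive t2 ->
     (forall p q, rho1 (t1 p) (t1 q) = rho1 p q) ->
     (forall p q, rho2 (t2 p) (t2 q) = rho2 p q) ->
     (forall a, exists b,
        rho1 (t1 (i1 a)) (i1 b) = 0 /\ rho2 (t2 (i2 a)) (i2 b) = 0) ->
     forall x y, rho (sum_map t1 t2 x) (sum_map t1 t2 y) = rho x y).
Proof.
exists amalgam; split; [split|split].
- exact: amalgam_pmet.
- exact: amalgam_valued.
- exact: amalgam_inl.
- exact: amalgam_inr.
- exact: amalgam_glue.
- exact: amalgam_eq0.
- exact: sum_map_isometry.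
Qed.

End Amalgam.

(** * Equivalent value sets give isomorphic topological groups *)

Section ValueTransport.
Context (R : realType).

Definition triangle_map (D L : set R) (f : R -> R) : Prop :=
  (forall x, D x -> L (f x)) /\
  (forall x y z, Delta_triangle D x y z -> Delta_triangle L (f x) (f y) (f z)).

Lemma equivalent_maps (D L : set R) : equivalent_value_sets D L ->
  exists f g, [/\ triangle_map D L f, triangle_map L D g,
    {in D, cancel f g} & {in L, cancel g f}].
Proof.
move=> [f [fD finj fsurj] ft].
have [g hg] : exists g : R -> R, forall y, L y -> D (g y) /\ f (g y) = y.
  have /choice[g hg] : forall y, exists x, L y -> D x /\ f x = y.
    move=> y; case: (pselect (L y)) => [/fsurj[x Dx xy]|nL]; last by exists 0.
    by exists x.
  by exists g.
have gf x : D x -> g (f x) = x.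
  move=> Dx; have [Dg e] := hg _ (fD _ Dx).
  by apply: finj => //; rewrite inE.
exists f, g; split.
- split => [x /fD//|x y z [Dx Dy Dz h]].
  by apply/ft => //; split.
- split => [y /hg[]//|x y z [Lx Ly Lz h]].
  have [Dx ex] := hg _ Lx; have [Dy ey] := hg _ Ly; have [Dz ez] := hg _ Lz.
  by apply/ft => //; rewrite ex ey ez; split.
- by move=> x; rewrite inE => /gf.
- by move=> y; rewrite inE => /hg[].
Qed.

Definition ext0 (f : R -> R) (r : R) : R := if r == 0 then 0 else f r.

Lemma ext0_pmet (D L : set R) (f : R -> R) (J : Type) (rho : J -> J -> R) :
  triangle_map D L f -> pmet rho -> valued D rho ->
  pmet (fun x y => ext0 f (rho x y)) /\ valued L (fun x y => ext0 f (rho x y)).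
Proof.
move=> [fL ft] hr hv; split; last first.
  move=> x y; rewrite /ext0; case: eqVneq => [_|r0]; first by left.
  by right; apply: fL; case: (hv x y) => // r00; rewrite r00 eqxx in r0.
have cg (x y z : J) : rho x y = 0 -> rho x z = rho y z.
  case: hr => h0 hs ht xy; apply/eqP; rewrite eq_le.
  have := ht x y z; have := ht y x z; rewrite (hs y x) xy !add0r.
  by move=> -> ->.
case: (hr) => h0 hs ht; split => [x|x y|x y z].
- by rewrite h0 /ext0 eqxx.
- by rewrite hs.
- have [xy|nxy] := eqVneq (rho x y) 0.
    by rewrite (cg x y z xy) xy /ext0 eqxx add0r.
  have [yz|nyz] := eqVneq (rho y z) 0.
    by rewrite (hs x z) -(cg y z x yz) (hs y x) yz /ext0 eqxx addr0.
  have [xz|nxz] := eqVneq (rho x z) 0.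
    rewrite xz (cg x z y xz) (hs z y) /ext0 eqxx (negPf nyz).
    have Dy : D (rho y z) by case: (hv y z) => // e; rewrite e eqxx in nyz.
    (* The image of an equilateral triangle shows that [f (rho y z)] is nonnegative. *)
    have [_ _ _] : Delta_triangle L (f (rho y z)) (f (rho y z)) (f (rho y z)).
      apply: ft; split => //; have := pmet_ge0 y z hr.
      by rewrite subrr normr0 => ->; rewrite lerDl; exact: pmet_ge0.
    by rewrite subrr normr0 => /andP[+ _]; lra.
  rewrite /ext0 (negPf nxy) (negPf nyz) (negPf nxz).
  have Dv (a b : J) : rho a b != 0 -> D (rho a b).
    by case: (hv a b) => // ->; rewrite eqxx.
  have [_ _ _ /andP[_ //]] : Delta_triangle L (f (rho x y)) (f (rho y z)) (f (rho x z)).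
  apply: ft; split; try exact: Dv.
  rewrite ht andbT ler_norml; have := ht x z y; have := ht y x z.
  by rewrite (hs y x) (hs z y); lra.
Qed.

(* If D accumulates at 0, pick r_k in D with 2 r_(k+1) < r_k; then f r_k halves
   at each step, and f r <= 2 f r_k as soon as r <= r_k. *)
Lemma triangle_map_small (D L : set R) (f : R -> R) :
  (forall x, D x -> 0 < x) -> (forall x, L x -> 0 < x) ->
  (forall x, D x -> L (f x)) ->
  (forall x y, D x -> D y -> (x <= y + y <-> f x <= f y + f y)) ->
  forall e, 0 < e -> exists2 d, 0 < d & forall r, D r -> r < d -> f r < e.
Proof.
move=> D0 L0 fL fd e e0.
case: (pselect (exists2 d, 0 < d & forall r, D r -> d <= r)) => [[d d0 hd]|nd].
  by exists d => // r /hd dr; rewrite ltNge dr.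
have sm d : 0 < d -> exists2 r, D r & r < d.
  move=> d0; apply: contrapT => nr; case: nd; exists d => // r Dr.
  by rewrite leNgt; apply/negP => rd; case: nr; exists r.
have [r0 Dr0 _] := sm 1 ltr01.
have dbl k : exists2 r, D r & f r * 2 ^+ k <= f r0.
  elim: k => [|k [r Dr hr]]; first by exists r0; rewrite // expr0 mulr1.
  have [|s Ds sr] := sm (r / 2); first by rewrite divr_gt0 // D0.
  exists s => //; apply: le_trans hr; rewrite exprS mulrA ler_pM2r ?exprn_gt0 //.
  have : ~ (f r <= f s + f s).
    by move=> /(fd r s Dr Ds); have := D0 _ Ds; lra.
  by move/negP; rewrite -ltNge; lra.
have f0 r : D r -> 0 < f r by move=> /fL/L0.
have [k hk] : exists k : nat, f r0 * 2 / e < 2 ^+ k.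
  have [k hk] : exists k : nat, f r0 * 2 / e < k%:R.
    exists (Num.bound (f r0 * 2 / e)).
    exact: archi_boundP (ltW (divr_gt0 (mulr_gt0 (f0 _ Dr0) _) e0)).
  exists k; apply: lt_trans hk _.
  by rewrite -natrX ltr_nat ltn_expl.
have [r Dr hr] := dbl k; exists r; first exact: D0.
move=> s Ds sr; have : s <= r + r by have := D0 _ Dr; lra.
move/(fd s r Ds Dr) => h; apply: le_lt_trans h _.
rewrite ltr_pdivrMr // in hk; have p0 : 0 < (2 : R) ^+ k by rewrite exprn_gt0.
rewrite -(ltr_pM2r p0); apply: le_lt_trans (_ : f r0 * 2 < _); last by rewrite [e * _]mulrC.
by rewrite mulrDl; lra.
Qed.

End ValueTransport.

Section Transport.
Context (R : realType) (X Y : metricType R) (b : X -> Y) (c : Y -> X).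
Hypotheses (bK : cancel b c) (cK : cancel c b).
Hypothesis biso : forall x x' y y', mdist x y = mdist x' y' ->
  mdist (b x) (b y) = mdist (b x') (b y').

Lemma transport_isometry (g : Iso X) : Defs.isometry (b \o g \o c).
Proof.
move=> x y /=; rewrite -{2}(cK x) -{2}(cK y).
by apply: biso; rewrite Iso_isometry.
Qed.

Lemma transport_surj (g : Iso X) y : exists x, (b \o g \o c) x = y.
Proof.
by exists (b (Iso_inv g (c y))); rewrite /= bK Iso_inv_funK cK.
Qed.

Definition transport (g : Iso X) : Iso Y :=
  MkIso (transport_isometry g) (transport_surj g).

Lemma transport_continuous : continuous b -> continuous transport.
Proof.
move=> cb; apply: (@continuous_comp_initial _ _ _ (@Iso_ptws R Y)) => g.
suff : {ptws, (@Iso_ptws R Y \o transport) @ nbhs g --> Iso_ptws (transport g)} by [].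
apply/pointwise_cvgP => y.
have ev : continuous (fun h : Iso X => h (c y)).
  move=> h; apply: (@continuous_comp _ _ _ (@Iso_ptws R X) (@proj X (fun=> X) (c y))).
    exact: initial_continuous.
  exact: proj_continuous.
apply: (@continuous_comp _ _ _ (fun h : Iso X => h (c y)) b); first exact: ev.
exact: cb.
Qed.

Lemma transportM : {morph transport : g h / (g * h)%g}.
Proof. by move=> g h; apply: Iso_eq => y /=; rewrite bK. Qed.

End Transport.

Section BackAndForth.
Context (R : realType) (D L : set R) (UD UL : metricType R).
Hypotheses (hD : distance_value_set D) (hL : distance_value_set L).
Hypotheses (hUD : urysohn_space D UD) (hUL : urysohn_space L UL).
Context (f g : R -> R).
Hypotheses (tf : triangle_map D L f) (tg : triangle_map L D g).
Hypotheses (fK : {in D, cancel f g}) (gK : {in L, cancel g f}).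

Let f0 r : r = 0 \/ D r -> ext0 f r = 0 -> r = 0.
Proof.
rewrite /ext0; case: eqVneq => // r0 [//|Dr] fr0.
by have := hL.1 _ (tf.1 _ Dr); rewrite fr0 ltxx.
Qed.

Let gf s : s = 0 \/ L s -> ext0 f (ext0 g s) = s.
Proof.
rewrite /ext0; case: (eqVneq s 0) => [->|s0 [/eqP|Ls]]; rewrite ?eqxx //.
  by rewrite (negPf s0).
have Dg := tg.1 _ Ls; have := hD.1 _ Dg; case: eqVneq => [->|_ _]; first by rewrite ltxx.
by rewrite gK // inE.
Qed.

Lemma urysohn_equivalence : exists b : UD -> UL, exists c : UL -> UD,
  [/\ cancel b c, cancel c b &
      forall x y, mdist (b x) (b y) = ext0 f (mdist x y)].
Proof.
have [x0 _] := urysohn_inhabited hD hUD; have [y0 _] := urysohn_inhabited hL hUL.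
have [enD enDP] : exists en : nat -> UD, forall x, exists n, en n = x.
  by apply: (countable_enum x0); case: hUD.
have [enL enLP] : exists en : nat -> UL, forall x, exists n, en n = x.
  by apply: (countable_enum y0); case: hUL.
pose P (E : seq UD) (h : UD -> UL) :=
  {in E &, forall x y, mdist (h x) (h y) = ext0 f (mdist x y)}.
have [|||b [_ bF bA]] := @generic_limit UD UL nat enD enDP P
  (fun n E h => enL n \in map h E) _ _ [::] (fun=> y0).
- move=> x E h Ph; pose J : finType := seq_sub (x :: E).
  have [pm vl] := ext0_pmet tf (@mdist_pmet R UD) (urysohn_valued hUD).
  have [|||e [he ee]] := @urysohn_extension R L UL hUL J
    (fun i j => ext0 f (mdist (val i) (val j))) (fun j => val j \in E) (fun j => h (val j)).
  + by case: pm => p1 p2 p3; split => [i|i j|i j k].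
  + by move=> i j.
  + by move=> i j iE jE; exact: Ph.
  have [i j /val_inj-> //|h' hh'] := lift_fun y0 (v := fun j : J => val j) (w := e).
  exists (x :: E), h'; split; last exact: mem_head.
  + move=> y z yE zE; rewrite (hh' (SeqSub yE)) (hh' (SeqSub zE)); exact: he.
  + split => y yE; first by rewrite inE yE orbT.
    have yE' : y \in x :: E by rewrite inE yE orbT.
    by rewrite (hh' (SeqSub yE')) ee.
- move=> n E h Ph; set y := enL n; pose J : finType := seq_sub (y :: map h E).
  have [pm vl] := ext0_pmet tg (@mdist_pmet R UL) (urysohn_valued hUL).
  (* [e0] inverts [h] on the image of [E]; [h] is injective there because [ext0 f] vanishes on
     distances only at 0. *)
  have [i j hij|e0 he0] := lift_fun x0 (v := fun j : seq_sub E => h (val j)) (w := val).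
    apply: (@mdist_positivity R); apply: f0; first exact: urysohn_valued.
    by rewrite -Ph ?hij ?mdistxx //; exact: ssvalP.
  have [|||e [he ee]] := @urysohn_extension R D UD hUD J
    (fun i j => ext0 g (mdist (val i) (val j))) (fun j => val j \in map h E) (fun j => e0 (val j)).
  + by case: pm => p1 p2 p3; split => [i|i j|i j k].
  + by move=> i j.
  + move=> i j /mapP[u uE ->] /mapP[v vE ->].
    rewrite (he0 (SeqSub uE)) (he0 (SeqSub vE)) Ph //=.
    rewrite /ext0; case: (eqVneq (mdist u v) 0) => [->|uv]; first by rewrite eqxx.
    have Duv : D (mdist u v) by case: (urysohn_valued hUD u v) => // e; rewrite e eqxx in uv.
    have := hL.1 _ (tf.1 _ Duv); case: eqVneq => [->|_ _]; first by rewrite ltxx.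
    by rewrite fK // inE.
  have [i j eij|h' hh'] := lift_fun y0 (v := e) (w := fun j : J => val j).
    apply: (@mdist_positivity R).
    have := he i j; rewrite eij mdistxx => /esym/(congr1 (ext0 f)).
    by rewrite gf ?/ext0 ?eqxx //; exact: urysohn_valued.
  exists (map e (enum J)), h'; split.
  + move=> _ _ /mapP[i _ ->] /mapP[j _ ->]; rewrite !hh' he gf //; exact: urysohn_valued.
  + have key u : u \in E -> exists2 j : J, e j = u & val j = h u.
      move=> uE; have huE : h u \in y :: map h E by rewrite inE map_f ?orbT.
      by exists (SeqSub huE) => //; rewrite ee /= ?map_f // (he0 (SeqSub uE)).
    split => u /key[j <-]; first by move=> _; rewrite map_f // mem_enum.
    by rewrite hh' => ->.
  + have yJ : y \in y :: map h E by exact: mem_head.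
    by rewrite -map_comp; apply/mapP; exists (SeqSub yJ); rewrite ?mem_enum //= hh'.
- by [].
have bd x y : mdist (b x) (b y) = ext0 f (mdist x y).
  have [E [h [Ph sE bE]]] := bF [:: x; y].
  by rewrite !bE ?Ph // sE // !inE eqxx ?orbT.
have bs y : exists x, b x = y.
  have [n <-] := enLP y; have [E [h [_ /mapP[x xE ->] bE]]] := bA n.
  by exists x; rewrite bE.
have /choice[c cK] := bs.
exists b, c; split => // x; apply: (@mdist_positivity R).
apply: f0; first exact: urysohn_valued.
by rewrite -bd cK mdistxx.
Qed.

End BackAndForth.

Section EquivalenceToTopology.
Context (R : realType) (D L : set R) (UD UL : metricType R).
Hypotheses (hD : distance_value_set D) (hL : distance_value_set L).
Hypotheses (hUD : urysohn_space D UD) (hUL : urysohn_space L UL).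

(** The inequality x <= 2y says that (y, y, x) is a triangle, a relation preserved in both
    directions. *)
Lemma triangle_map_double (A B : set R) (f g : R -> R) :
  (forall x, A x -> 0 < x) -> (forall x, B x -> 0 < x) ->
  triangle_map A B f -> triangle_map B A g -> {in A, cancel f g} ->
  forall x y, A x -> A y -> (x <= y + y <-> f x <= f y + f y).
Proof.
move=> A0 B0 tf tg fK x y Ax Ay.
have dbl (C : set R) u v : (forall x, C x -> 0 < x) -> C u -> C v ->
    u <= v + v <-> Delta_triangle C v v u.
  move=> C0 Cu Cv; rewrite /Delta_triangle subrr normr0 (ltW (C0 _ Cu)).
  by split => [h|[_ _ _ //]]; split.
split.
  by move/(dbl A _ _ A0 Ax Ay)/tf.2/(dbl B _ _ B0 (tf.1 _ Ax) (tf.1 _ Ay)).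
move/(dbl B _ _ B0 (tf.1 _ Ax) (tf.1 _ Ay))/tg.2.
by rewrite !fK ?inE // => /(dbl A _ _ A0 Ax Ay).
Qed.

Lemma ext0_continuous (A B : set R) (f g : R -> R) (X Y : metricType R)
    (b : X -> Y) :
  (forall x, A x -> 0 < x) -> (forall x, B x -> 0 < x) ->
  triangle_map A B f -> triangle_map B A g -> {in A, cancel f g} ->
  valued A (@mdist R X) ->
  (forall x y, mdist (b x) (b y) = ext0 f (mdist x y)) -> continuous b.
Proof.
move=> A0 B0 tf tg fK vX hb x.
have sm := triangle_map_small A0 B0 tf.1 (triangle_map_double A0 B0 tf tg fK).
apply/metricType_numDomainType.cvgrPdist_lt => e e0; have [d d0 hd] := sm _ e0.
apply/metricType_numDomainType.nbhs_mdistP; exists d => //= y xy; rewrite hb /ext0.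
case: eqVneq => [//|n0]; apply: hd => //.
by case: (vX x y) => // z; rewrite z eqxx in n0.
Qed.

Lemma equivalent_topologically_isomorphic :
  equivalent_value_sets D L -> Iso_topologically_isomorphic UD UL.
Proof.
move=> /equivalent_maps[f [g [tf tg fK gK]]].
have [b [c [bK cK bd]]] := urysohn_equivalence hD hL hUD hUL tf tg fK gK.
have gf r : r = 0 \/ D r -> ext0 g (ext0 f r) = r.
  rewrite /ext0; case: (eqVneq r 0) => [->|r0 [/eqP|Dr]]; rewrite ?eqxx //.
    by rewrite (negPf r0).
  have Lf := tf.1 _ Dr; have := hL.1 _ Lf.
  by case: eqVneq => [->|_ _]; rewrite ?ltxx // fK // inE.
have cd x y : mdist (c x) (c y) = ext0 g (mdist x y).
  rewrite -{2}(cK x) -{2}(cK y) bd gf //; exact: urysohn_valued.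
have bi x x' y y' : mdist x y = mdist x' y' -> mdist (b x) (b y) = mdist (b x') (b y').
  by move=> e; rewrite !bd e.
have ci x x' y y' : mdist x y = mdist x' y' -> mdist (c x) (c y) = mdist (c x') (c y').
  by move=> e; rewrite !cd e.
pose m := isMultiplicative.Build _ _ (transport bK cK bi) (transportM bK cK bi).
pose phi : {multiplicative Iso UD -> Iso UL} := HB.pack (transport bK cK bi) m.
exists phi, (transport cK bK ci); split.
- by move=> h; apply: Iso_eq => x /=; rewrite !bK.
- by move=> h; apply: Iso_eq => x /=; rewrite !cK.
- apply: transport_continuous.
  by apply: (ext0_continuous hD.1 hL.1 tf tg fK _ bd); exact: urysohn_valued.
- apply: transport_continuous.
  by apply: (ext0_continuous hL.1 hD.1 tg tf gK _ cd); exact: urysohn_valued.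
Qed.

End EquivalenceToTopology.

(** * Supports of subgroups *)

Definition is_subgroup (G : groupType) (K : set G) : Prop :=
  [/\ K 1%g, forall g h, K g -> K h -> K (g * h)%g & forall g, K g -> K (g^-1)%g].

Lemma seq_argmin (R : realType) (T : eqType) (F : T -> R) (s : seq T) :
  s != [::] -> exists2 e, e \in s & {in s, forall x, F e <= F x}.
Proof.
elim: s => // x [|y s] IH _.
  by exists x; rewrite ?mem_head // => z; rewrite inE => /eqP ->.
have [//|e es le_e] := IH; have [xe|ex] := leP (F x) (F e).
- exists x; first exact: mem_head.
  move=> z; rewrite inE => /orP[/eqP ->//|/le_e]; exact: le_trans.
- exists e; first by rewrite inE es orbT.
  by move=> z; rewrite inE => /orP[/eqP ->|/le_e//]; exact: ltW.
Qed.

Section Supports.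
Context (R : realType) (D : set R) (U : metricType R) (r0 : R).
Hypotheses (hD : distance_value_set D) (hU : urysohn_space D U) (Dr0 : D r0).
Implicit Types (A B : seq U) (K : set (Iso U)).

Definition fixes A (g : Iso U) : Prop := {in A, forall x, g x = x}.

Definition supports A K : Prop := forall g, fixes A g -> K g.

Lemma homogeneous_point (F : seq U) (a b : U) :
  {in F, forall x, mdist a x = mdist b x} -> exists2 g : Iso U, fixes F g & g a = b.
Proof.
move=> ab; pose J : finType := option (seq_sub F).
have [] := @partial_isometry_extends R D U hU J
  (fun j => if j is Some x then val x else a) (fun j => if j is Some x then val x else b).
  move=> [x|] [y|] //=; rewrite ?mdistxx //.
    by rewrite metric_sym ab ?(metric_sym b) //; exact: ssvalP.
  by rewrite ab //; exact: ssvalP.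
move=> g hg; exists g; last exact: (hg None).
by move=> x xF; exact: (hg (Some (SeqSub xF))).
Qed.

Lemma dist_in (x y : U) : x != y -> D (mdist x y).
Proof. by case: hU => _ h _ _; exact: h. Qed.

Lemma point_at_distance (x : U) (r : R) : D r -> exists w : U, mdist w x = r.
Proof.
move=> Dr; have [|||w hw] := @katetov_point R D U hD hU [:: x] (fun=> r).
- by [].
- by move=> y z _ _; rewrite lerDl mdist_ge0.
- move=> y z; rewrite !inE => /eqP -> /eqP ->; rewrite mdistxx.
  by have := hD.1 _ Dr; lra.
by exists w; rewrite hw ?mem_head.
Qed.

Lemma movable (x : U) : exists g : Iso U, g x != x.
Proof.
have [w wx] := point_at_distance x Dr0.
have [//|g _ gx] := @homogeneous_point [::] x w; exists g; rewrite gx -(mdist_gt0 (R := R)).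
by rewrite wx; exact: hD.1.
Qed.

Lemma subgroup_conj_supports K A (k : Iso U) : is_subgroup K -> K k ->
  supports A K -> supports (map k A) K.
Proof.
move=> [K1 KM KV] Kk sA g gA.
have -> : g = (k * (k^-1 * g * k) * k^-1)%g by rewrite !mulgA mulgV mul1g mulgK.
apply: (KM); last exact: (KV); apply: (KM) => //; apply: sA => x xA.
by rewrite /= gA ?map_f // Iso_funK.
Qed.

Section RemovePoint.
Context (K : set (Iso U)) (A B : seq U) (a : U).
Hypotheses (hK : is_subgroup K) (aA : a \notin A) (aB : a \notin B).
Hypotheses (sA : supports (a :: A) K) (sB : supports B K).

(* All pairs at distance t are good as soon as one is, by homogeneity over A;
   midpoints then double the good distances until they exceed d(a, g a). *)
Let good t := forall g : Iso U, fixes A g -> mdist a (g a) = t -> K g.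

Let ne x : x \in A -> x != a.
Proof. by move=> xA; apply: contraNneq aA => <-. Qed.

(** The inequalities s <= 2t and t <= 2 d(a, e) allow a point [w] at distance t from both [a] and
    [g a], and as far from each point of [A] as [a] is. If [k] fixes [A] and takes [a] to [w], both
    factors of g = k (k^-1 g) move [a] by t. *)
Let good_double t s : D t -> {in A, forall e, t <= mdist a e + mdist a e} ->
  good t -> s <= t + t -> good s.
Proof.
move=> Dt tA gt st g gA gs; have t0 := hD.1 _ Dt.
pose f x := if (x == a) || (x == g a) then t else mdist a x.
have fA x : x \in A -> f x = mdist a x.
  move=> xA; rewrite /f (negPf (ne xA)) /=; case: eqP => // xga.
  by have := ne xA; rewrite -(inj_eq (@Iso_inj _ _ g)) gA // -xga eqxx.
have fa : f a = t by rewrite /f eqxx.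
have fga : f (g a) = t by rewrite /f eqxx orbT.
have dga x : x \in A -> mdist (g a) x = mdist a x.
  by move=> xA; rewrite -{1}(gA x xA) Iso_isometry.
have [|||w hw] := @katetov_point R D U hD hU [:: a, g a & A] f.
- move=> x; rewrite !inE => /or3P[/eqP->|/eqP->|xA]; rewrite ?fa ?fga //.
  by rewrite fA //; apply: dist_in; rewrite eq_sym ne.
- move=> x y; rewrite !inE => /or3P[/eqP->|/eqP->|xA] /or3P[/eqP->|/eqP->|yA];
    rewrite ?fa ?fga ?lerDl ?mdist_ge0 //.
  + by rewrite fA // tA.
  + by rewrite fA // dga // tA.
  + by rewrite fA // (metric_sym x); lra.
  + by rewrite fA // (metric_sym x) dga //; lra.
  + rewrite !fA // (metric_sym x); exact: metric_triangle.
- move=> x y; rewrite !inE => /or3P[/eqP->|/eqP->|xA] /or3P[/eqP->|/eqP->|yA];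
    rewrite ?fa ?fga ?mdistxx ?addr_ge0 ?(ltW t0) //.
  + by rewrite gs.
  + by rewrite fA //; lra.
  + by rewrite metric_sym gs.
  + by rewrite fA // dga //; lra.
  + by rewrite fA // metric_sym; lra.
  + by rewrite fA // metric_sym dga //; lra.
  + rewrite !fA // (metric_sym a x); exact: metric_triangle.
have [x xA|k kA ka] := @homogeneous_point A a w.
  by rewrite hw ?fA // !inE xA !orbT.
have Kk : K k by apply: gt => //; rewrite ka metric_sym hw ?fa // inE eqxx.
case: hK => K1 KM KV.
have -> : g = (k * (k^-1 * g))%g by rewrite mulgA mulgV mul1g.
apply: (KM) => //; apply: gt => [x xA|].
  by rewrite /= gA // -{1}(kA x xA) Iso_funK.
rewrite /= -(Iso_isometry k) ka Iso_inv_funK hw ?fga //.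
by rewrite !inE eqxx orbT.
Qed.

(** Here t is the least distance from [a] to [A] and [B], so a point [w] exists at distance t from
    [a] with the same distances as [a] to [A] and [B]. Some [b] fixing [B] takes [a] to [w], and
    some [h] fixing [a] and [A] takes [g a] to [w]. Both are in [K], and b^-1 h g fixes [a] and
    [A]. *)
Let good_start : A ++ B != [::] -> exists t,
  [/\ D t, {in A, forall e, t <= mdist a e + mdist a e} & good t].
Proof.
move=> /(seq_argmin (mdist a))[e eAB emin].
have nab x : x \in A ++ B -> a != x.
  by rewrite mem_cat; apply: contraTneq => <-; rewrite negb_or aA.
have De : D (mdist a e) by apply: dist_in; rewrite nab.
have e0 := hD.1 _ De.
exists (mdist a e); split => // [x xA|].
  have := emin x; rewrite mem_cat xA /= => /(_ isT); have := mdist_ge0 a x; lra.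
move=> g gA ga; pose f x := if x == a then mdist a e else mdist a x.
have fa : f a = mdist a e by rewrite /f eqxx.
have fx x : x \in A ++ B -> f x = mdist a x.
  by move=> xAB; rewrite /f eq_sym (negPf (nab _ xAB)).
have [|||w hw] := @katetov_point R D U hD hU (a :: A ++ B) f.
- move=> x; rewrite inE => /orP[/eqP->|xA]; rewrite ?fa // fx //.
  by apply: dist_in; rewrite nab.
- move=> x y; rewrite !(inE, in_cons) => /orP[/eqP->|xA] /orP[/eqP->|yA];
    rewrite ?fa ?lerDl ?mdist_ge0 //.
  + by rewrite fx //; have := emin _ yA; have := mdist_ge0 a y; lra.
  + by rewrite fx // (metric_sym x); lra.
  + rewrite !fx // (metric_sym x); exact: metric_triangle.
- move=> x y; rewrite !(inE, in_cons) => /orP[/eqP->|xA] /orP[/eqP->|yA];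
    rewrite ?fa ?mdistxx ?addr_ge0 ?mdist_ge0 //.
  + by rewrite fx //; lra.
  + by rewrite fx // metric_sym; lra.
  + rewrite !fx // (metric_sym a x); exact: metric_triangle.
have wx x : x \in A ++ B -> mdist w x = mdist a x.
  by move=> xA; rewrite hw ?fx // inE xA orbT.
have wa : mdist w a = mdist a e by rewrite hw ?fa // mem_head.
have [x xAB|b bAB ba] := @homogeneous_point (A ++ B) a w.
  by rewrite wx.
have [x|h hA hga] := @homogeneous_point (a :: A) (g a) w.
  rewrite inE => /orP[/eqP->|xA]; first by rewrite wa metric_sym ga.
  by rewrite wx ?mem_cat ?xA // -{1}(gA x xA) Iso_isometry.
case: hK => K1 KM KV.
have Kb : K b by apply: sB => x xB; rewrite bAB // mem_cat xB orbT.
have Kh : K h by exact: sA.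
have -> : g = (h^-1 * (b * (b^-1 * h * g)))%g by rewrite !mulgA mulgK mulVg mul1g.
apply: (KM); first exact: (KV); apply: (KM) => //; apply: sA => x.
rewrite inE => /orP[/eqP->|xA] /=; first by rewrite hga -ba Iso_funK.
rewrite gA // hA ?inE ?xA ?orbT // -{1}(bAB x) ?Iso_funK //.
by rewrite mem_cat xA.
Qed.

Lemma support_remove : supports A K.
Proof.
have [e|] := eqVneq (A ++ B) [::].
  move=> g _; apply: sB => x; suff -> : B = [::] by [].
  by case: A e.
move=> /good_start[t [Dt tA gt]] g gA.
have [ga|ga] := eqVneq (g a) a.
  apply: sA => x; rewrite inE => /orP[/eqP->//|/gA//].
have Ds : D (mdist a (g a)) by apply: dist_in; rewrite eq_sym.
have sle : {in A, forall e, mdist a (g a) <= mdist a e + mdist a e}.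
  move=> e eA; have := metric_triangle a e (g a).
  suff -> : mdist e (g a) = mdist a e by [].
  by rewrite -{1}(gA e eA) Iso_isometry metric_sym.
have [n hn] : exists n : nat, mdist a (g a) <= 2 ^+ n * (t + t).
  have t0 := hD.1 _ Dt.
  exists (Num.bound (mdist a (g a) / (t + t))).
  rewrite -ler_pdivrMr ?addr_gt0 //; apply/ltW.
  apply: lt_trans (archi_boundP (divr_ge0 (mdist_ge0 _ _) (ltW (addr_gt0 t0 t0)))) _.
  by rewrite -natrX ltr_nat ltn_expl.
elim: n t Dt tA gt hn => [|n IH] t Dt tA gt.
  by rewrite expr0 mul1r => st; exact: (good_double Dt tA gt st gA).
have [st _|ts hn] := leP (mdist a (g a)) (t + t).
  exact: (good_double Dt tA gt st gA).
apply: (IH (t + t)).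
(* Since t + t stays below the element d(a, g a) of [D], truncation leaves it alone and it belongs
   to [D]. *)
- have := vtruncDr hD Dt Dt; have [[M [M0 ub E]]|->//] := vtrunc_cases hD Ds.
  by rewrite E minEle (le_trans (ltW ts)) // ub.
- by move=> e eA; apply: le_trans (sle e eA); exact: ltW.
- exact: (good_double Dt tA gt).
- by move: hn; rewrite exprS [2 * _]mulrC -mulrA; congr (_ <= _ * _); lra.
Qed.

End RemovePoint.

Lemma eq_supports A B K : A =i B -> supports A K -> supports B K.
Proof. by move=> AB sA g gB; apply: sA => x; rewrite AB; exact: gB. Qed.

(** The points of [A] outside [B] are removed one at a time, with [B] as the second support each
    time. *)
Lemma support_inter K A B : is_subgroup K -> supports A K -> supports B K ->
  supports [seq x <- A | x \in B] K.
Proof.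
move=> hK sA sB; set C := [seq x <- A | x \in B].
have : supports ([seq x <- A | x \notin B] ++ C) K.
  apply: eq_supports sA => x; rewrite /C mem_cat !mem_filter.
  by case: (x \in B); rewrite //= orbF.
have : {in [seq x <- A | x \notin B], forall x, x \notin B}.
  by move=> x; rewrite mem_filter => /andP[].
elim: [seq x <- A | x \notin B] => //= x l IH hl sl; apply: IH.
  by move=> y yl; apply: hl; rewrite inE yl orbT.
have [xl|xl] := boolP (x \in l ++ C).
  by apply: eq_supports sl => y; rewrite inE; case: eqP => [->|].
by apply: (support_remove hK xl _ sl sB); apply: hl; exact: mem_head.
Qed.

(** The points [x] and [k x] give two disjoint supports, so the empty set supports [K]. *)
Lemma stabilizer_maximal K (x : U) (k : Iso U) : is_subgroup K ->
  supports [:: x] K -> K k -> k x != x -> forall g, K g.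
Proof.
move=> hK sx Kk kx g.
have /= := support_inter hK sx (subgroup_conj_supports hK Kk sx).
by rewrite inE eq_sym (negPf kx); apply.
Qed.

(** A support of least size is invariant: if [k] moved a point of [A] out of [A], the intersection
    of [A] with its image under k^-1 would be a smaller support. It is nonempty because [K] is
    proper. *)
Lemma invariant_support K A : is_subgroup K -> supports A K ->
  (exists g, ~ K g) -> exists B, [/\ B != [::], supports B K &
    forall k x, K k -> x \in B -> k x \in B].
Proof.
move=> hK sA [g Kg].
have [n] := ubnP (size A); elim: n A sA => // n IH A sA; rewrite ltnS => sz.
have [inv|ninv] := pselect (forall k x, K k -> x \in A -> k x \in A).
  exists A; split => //; apply/eqP => A0; apply: Kg; apply: sA.
  by rewrite A0.
have [k [x [Kk xA kx]]] : exists k x, [/\ K k, x \in A & k x \notin A].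
  apply: contrapT => h; apply: ninv => k x Kk xA; apply: contrapT => /negP kx.
  by apply: h; exists k, x.
have Kk' : K (k^-1)%g by case: hK => _ _; exact.
apply: (IH _ (support_inter hK sA (subgroup_conj_supports hK Kk' sA))).
apply: leq_trans sz; rewrite size_filter -(count_predC (mem (map (k^-1)%g A))).
rewrite -[X in (X < _)%N]addn0 ltn_add2l -has_count; apply/hasP; exists x => //=.
apply/mapP => -[y yA xy]; move: kx; rewrite xy /= Iso_inv_funK.
by rewrite yA.
Qed.

(** Two copies of [F] with [x] added are amalgamated over [x] alone; [h] takes the first copy to the
    second. *)
Lemma disjoint_copy (x : U) (F : seq U) : exists h : Iso U,
  h x = x /\ {in F, forall z, z != x -> h z \notin F}.
Proof.
pose J : finType := seq_sub (x :: F).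
have xJ : x \in x :: F by exact: mem_head.
pose x' : J := SeqSub xJ; pose rho (i j : J) := mdist (val i) (val j).
have pm : pmet rho.
  by case: (mdist_pmet U) => p1 p2 p3; split => *; [exact: p1|exact: p2|exact: p3].
have vl : valued D rho by move=> i j; exact: urysohn_valued.
pose i (_ : unit) : J := x'.
have h12 (a b : unit) : rho (i a) (i b) = rho (i a) (i b) by [].
have [am [[amp amv aml amr amg] [am0 _]]] := amalgamation hD Dr0 pm pm vl vl tt h12.
have [] := @urysohn_extension R D U hU (J + J)%type am (fun j => if j is inl _ then True else False)
  (fun j => if j is inl i then val i else x) amp amv.
  by move=> [u|u] [v|v] // _ _; rewrite aml.
move=> e [he ee].
have [] := @partial_isometry_extends R D U hU J (fun j => val j) (fun j => e (inr j)).
  by move=> u v; rewrite he amr.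
move=> h hh; exists h; split.
  rewrite (hh x'); apply: (@mdist_positivity R).
  by rewrite -[X in mdist _ X](ee (inl x')) // he; case: amp => _ -> _; rewrite (amg tt).
move=> z zF zx; apply/negP => hz.
have zJ : z \in x :: F by rewrite inE zF orbT.
have hzJ : h z \in x :: F by rewrite inE hz orbT.
have : am (inl (SeqSub hzJ)) (inr (SeqSub zJ)) = 0.
  by rewrite -he ee // -(hh (SeqSub zJ)) mdistxx.
move/am0 => [_ [_ /(@mdist_positivity R)]] /= xz.
by rewrite xz eqxx in zx.
Qed.

(** Conjugating by an [h] that fixes [x] makes the image of [F] under [h] a support too. For a
    disjoint copy, the two supports meet at most in [x]. *)
Lemma normal_open_stabilizer (N : set (Iso U)) (x : U) (F : seq U) :
  is_subgroup N -> supports F N ->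
  (forall h g : Iso U, h x = x -> N g -> N (h * g * h^-1)%g) ->
  forall g : Iso U, g x = x -> N g.
Proof.
move=> hN sF nN g gx; have [h [hx hF]] := disjoint_copy x F.
have sF' : supports (map h F) N.
  move=> k kF; have -> : k = (h * (h^-1 * k * h) * h^-1)%g.
    by rewrite !mulgA mulgV mul1g mulgK.
  apply: nN => //; apply: sF => y yF.
  by rewrite /= kF ?map_f // Iso_funK.
apply: (support_inter hN sF sF') => y; rewrite mem_filter => /andP[/mapP[z zF ->]].
by have [->|/(hF z zF)/negPf->//] := eqVneq z x; rewrite !hx.
Qed.

End Supports.

(** * Recovering distances and triangles from point stabilizers *)

Section Reconstruction.
Context (R : realType).

Lemma dist_triangle (Z : metricType R) (x y z : Z) :
  `|mdist x y - mdist y z| <= mdist x z <= mdist x y + mdist y z.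
Proof.
rewrite metric_triangle andbT ler_norml.
have := metric_triangle x z y; have := metric_triangle y x z.
by rewrite (metric_sym z y) (metric_sym y x); lra.
Qed.

Lemma triangle_realized (E : set R) (Z : metricType R) (u v w : R) :
  distance_value_set E -> urysohn_space E Z -> E u -> E v -> E w ->
  `|u - v| <= w <= u + v ->
  exists x y z : Z, [/\ mdist x y = u, mdist y z = v & mdist x z = w].
Proof.
move=> hE hZ Eu Ev Ew /andP[/ler_normlP[uv vu] wuv].
have u0 := hE.1 _ Eu; have v0 := hE.1 _ Ev; have w0 := hE.1 _ Ew.
have [y _] := urysohn_inhabited hE hZ.
have [x xy] := point_at_distance hE hZ y Eu.
have nyx : y == x = false.
  by apply/negbTE; rewrite eq_sym -(mdist_gt0 (R := R)) xy.
have [|||z hz] := @katetov_point R E Z hE hZ [:: x; y] (fun t => if t == x then w else v).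
- by move=> t _; case: ifP.
- move=> s t; rewrite !inE => /orP[]/eqP-> /orP[]/eqP->;
    rewrite ?eqxx ?nyx ?mdistxx ?addr0 // ?xy ?(metric_sym y) ?xy; lra.
- move=> s t; rewrite !inE => /orP[]/eqP-> /orP[]/eqP->;
    rewrite ?eqxx ?nyx ?mdistxx ?addr0 // ?xy ?(metric_sym y) ?xy; lra.
exists x, y, z; split => //; rewrite metric_sym hz ?inE ?eqxx ?orbT //.
by rewrite nyx.
Qed.

(** The image [K] of the stabilizer of [x] is open and proper, so it leaves a nonempty finite
    support [B] invariant. The pullback [N] of the pointwise stabilizer of [B] is open and
    normalized by the stabilizer of [x], hence contains it. So [K] fixes each [y] in [B], and
    maximality of the stabilizer of [x] gives the equivalence. *)
Lemma stabilizer_image (D L : set R) (X Y : metricType R) (r0 s0 : R)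
    (phi : Iso X -> Iso Y) (psi : Iso Y -> Iso X) :
  distance_value_set D -> distance_value_set L -> D r0 -> L s0 ->
  urysohn_space D X -> urysohn_space L Y ->
  {morph phi : g h / (g * h)%g} -> cancel phi psi -> cancel psi phi ->
  (forall x : X, exists A : seq Y, supports A [set h | psi h x = x]) ->
  (forall y : Y, exists A : seq X, supports A [set g | phi g y = y]) ->
  forall x : X, exists y : Y, forall g : Iso X, g x = x <-> phi g y = y.
Proof.
move=> hD hL Dr Ls hX hY phiM phiK psiK openX openY x.
have phi1 : phi 1%g = 1%g.
  by apply: (mulgI (phi 1%g)); rewrite -phiM !mulg1.
have phiV g : phi (g^-1)%g = ((phi g)^-1)%g.
  by apply: (mulgI (phi g)); rewrite -phiM !mulgV.
have psiM : {morph psi : g h / (g * h)%g}.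
  by move=> g h; rewrite -{1}(psiK g) -{1}(psiK h) -phiM phiK.
have psi1 : psi 1%g = 1%g by rewrite -phi1 phiK.
have psiV g : psi (g^-1)%g = ((psi g)^-1)%g.
  by rewrite -{1}(psiK g) -phiV phiK.
pose K := [set h | psi h x = x].
have hK : is_subgroup K.
  split => [|g h|g]; rewrite /K /=; first by rewrite psi1.
    by rewrite psiM /= => gx ->.
  by rewrite psiV /= => gx; rewrite -{1}gx Iso_funK.
have [A sA] := openX x.
have [B [B0 sB iB]] : exists B, [/\ B != [::], supports B K &
    forall k y, K k -> y \in B -> k y \in B].
  apply: (invariant_support hL hY hK sA).
  have [g /eqP gx] := movable hD hX Dr x.
  by exists (phi g); rewrite /K /= phiK.
have [y yB] : exists y, y \in B by case: B B0 {sB iB} => // y B _; exists y; exact: mem_head.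
pose N := [set g | fixes B (phi g)].
have hN : is_subgroup N.
  split => [z zB|g h gN hN z zB|g gN z zB]; rewrite ?phi1 ?phiM ?phiV //=.
    by rewrite hN // gN.
  by rewrite -{1}(gN _ zB) Iso_funK.
have [F sF] : exists F, supports F N.
  rewrite /N; elim: (B) => [|z C [F sF]]; first by exists [::] => g _ z.
  have [F' sF'] := openY z; exists (F' ++ F) => g gF u; rewrite inE => /orP[/eqP->|uC].
    by apply: sF' => v vF; apply: gF; rewrite mem_cat vF.
  by apply: sF uC => v vF; apply: gF; rewrite mem_cat vF orbT.
have fixB : forall g : Iso X, g x = x -> N g.
  apply: (normal_open_stabilizer hD hX Dr hN sF) => h g hx gN z zB.
  rewrite !phiM phiV /= gN ?Iso_inv_funK //.
  have : K ((phi h)^-1)%g by case: hK => _ _; apply; rewrite /K /= phiK.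
  by move=> /iB; apply.
exists y => g; split => [/fixB/(_ y yB)//|gy].
apply: contrapT => /eqP gx.
pose S := [set g | phi g y = y].
have hS : is_subgroup S.
  split => [|h k|h]; rewrite /S /= ?phi1 ?phiM ?phiV //=; first by move=> hy ->.
  by move=> hy; rewrite -{1}hy Iso_funK.
have sS : supports [:: x] S by move=> h hx; apply: (fixB h _ y yB); apply: hx; exact: mem_head.
have full := stabilizer_maximal hD hX hS sS gy gx.
have [h /eqP hy] := movable hL hY Ls y.
by apply: hy; have := full (psi h); rewrite /S /= psiK.
Qed.

(** If [x] and [y] differed, the stabilizer of [y] would have the disjoint supports {x} and {y}, and
    so be the whole group. *)
Lemma stabilizer_inj (D : set R) (X : metricType R) (r0 : R) (x y : X) :
  distance_value_set D -> D r0 -> urysohn_space D X ->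
  (forall g : Iso X, g x = x -> g y = y) -> x = y.
Proof.
move=> hD Dr hX xy; apply/eqP; apply: contraT => nxy.
pose K := [set g : Iso X | g y = y].
have hK : is_subgroup K.
  split => [//|g h|g]; rewrite /K /=; first by move=> gy ->.
  by move=> gy; rewrite -{1}gy Iso_funK.
have sx : supports [:: x] K by move=> g gx; apply: xy; apply: gx; exact: mem_head.
have sy : supports [:: y] K by move=> g gy; apply: gy; exact: mem_head.
have := support_inter hD hX hK sx sy; rewrite /= inE (negPf nxy) => full.
have [g /eqP gy] := movable hD hX Dr y.
by case: gy; apply: full.
Qed.

Lemma equivalence_of_isomorphism (D L : set R) (X Y : metricType R) (r0 s0 : R)
    (phi : Iso X -> Iso Y) (psi : Iso Y -> Iso X) :
  distance_value_set D -> distance_value_set L -> D r0 -> L s0 ->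
  urysohn_space D X -> urysohn_space L Y ->
  {morph phi : g h / (g * h)%g} -> cancel phi psi -> cancel psi phi ->
  (forall x : X, exists A : seq Y, supports A [set h | psi h x = x]) ->
  (forall y : Y, exists A : seq X, supports A [set g | phi g y = y]) ->
  equivalent_value_sets D L.
Proof.
move=> hD hL Dr Ls hX hY phiM phiK psiK openX openY.
have psiM : {morph psi : g h / (g * h)%g}.
  by move=> g h; rewrite -{1}(psiK g) -{1}(psiK h) -phiM phiK.
have /choice[b hb] := stabilizer_image hD hL Dr Ls hX hY phiM phiK psiK openX openY.
have /choice[c hc] := stabilizer_image hL hD Ls Dr hY hX psiM psiK phiK openY openX.
have cK : cancel c b.
  move=> y; apply: (stabilizer_inj hL Ls hY) => h; rewrite -{1}(psiK h) -hb.
  by move/hc.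
(* Stabilizers determine [b], and g conjugates the stabilizer of x to that of g x; hence [b] is
   equivariant along [phi]. *)
have bE (g : Iso X) x : b (g x) = phi g (b x).
  apply: (stabilizer_inj hL Ls hY) => h; rewrite -{1}(psiK h) -hb => hx.
  have : (g^-1 * psi h * g)%g x = x by rewrite /= hx Iso_funK.
  move/hb; rewrite !phiM psiK /= => /(congr1 (phi g)).
  have -> : phi (g^-1)%g = ((phi g)^-1)%g.
    apply: (mulgI (phi g)); rewrite -phiM !mulgV.
    by apply: (mulgI (phi 1%g)); rewrite -phiM !mulg1.
  by rewrite /= Iso_inv_funK.
(* Pairs with the same distance form one orbit, so the equivariant [b] respects equality of
   distances, and so does its inverse. *)
have move_pair (Z : metricType R) (E : set R) (x y x' y' : Z) : urysohn_space E Z ->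
    mdist x y = mdist x' y' -> exists g : Iso Z, g x = x' /\ g y = y'.
  move=> hZ e; have [] := @partial_isometry_extends R E Z hZ bool
    (fun i => if i then x else y) (fun i => if i then x' else y').
    by move=> [] []; rewrite ?mdistxx // metric_sym e metric_sym.
  by move=> g hg; exists g; split; [exact: (hg true)|exact: (hg false)].
have bd x y x' y' : mdist x y = mdist x' y' -> mdist (b x) (b y) = mdist (b x') (b y').
  by move=> /(move_pair _ _ _ _ _ _ hX)[g [<- <-]]; rewrite !bE Iso_isometry.
have bd' x y x' y' : mdist (b x) (b y) = mdist (b x') (b y') -> mdist x y = mdist x' y'.
  move=> /(move_pair _ _ _ _ _ _ hY)[h []]; rewrite -{1 2}(psiK h) -!bE => e1 e2.
  have binj : injective b.
    move=> u v uv; apply: (stabilizer_inj hD Dr hX) => g.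
    by rewrite !hb uv.
  by rewrite -(binj _ _ e1) -(binj _ _ e2) Iso_isometry.
have pair r : D r -> exists xy : X * X, mdist xy.1 xy.2 = r.
  move=> Dr'; have [x _] := urysohn_inhabited hD hX.
  by have [w wx] := point_at_distance hD hX x Dr'; exists (w, x).
have [x0 _] := urysohn_inhabited hD hX.
have [xy hxy] : exists xy : R -> X * X, forall r, D r -> mdist (xy r).1 (xy r).2 = r.
  have /choice[xy h] : forall r, exists p : X * X, D r -> mdist p.1 p.2 = r.
    move=> r; case: (pselect (D r)) => [/pair[p hp]|nr]; first by exists p.
    by exists (x0, x0).
  by exists xy.
(* The pair chosen for r is immaterial, by [bd]. *)
pose f r := mdist (b (xy r).1) (b (xy r).2).
have fE x y : D (mdist x y) -> f (mdist x y) = mdist (b x) (b y).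
  by move=> Dxy; apply: bd; rewrite hxy.
have bne x y : x != y -> b x != b y.
  move=> nxy; rewrite -(mdist_gt0 (R := R)).
  have : mdist (b x) (b y) != mdist (b x) (b x).
    apply: contra nxy => /eqP /bd'; rewrite mdistxx => /(@mdist_positivity R) ->.
    exact: eqxx.
  by rewrite mdistxx lt_def mdist_ge0 andbT.
have fL' r : D r -> L (f r).
  move=> Dr'; apply: (dist_in hY); apply: bne.
  by rewrite -(mdist_gt0 (R := R)) hxy //; exact: hD.1.
have fL x y : D (mdist x y) -> L (mdist (b x) (b y)) by move=> Dxy; rewrite -fE //; exact: fL'.
exists f.
  split.
  - exact: fL'.
  - move=> r s; rewrite !inE => Dr' Ds rs.
    by rewrite -(hxy r Dr') -(hxy s Ds); exact: bd'.
  - move=> s Ls' /=; have [y1 _] := urysohn_inhabited hL hY.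
    have [w wy] := point_at_distance hL hY y1 Ls'.
    have nc : c w != c y1.
      apply/eqP => /(congr1 b); rewrite !cK => wy1.
      by have := hL.1 _ Ls'; rewrite -wy wy1 mdistxx ltxx.
    have Dc := dist_in hX nc.
    by exists (mdist (c w) (c y1)) => //; rewrite fE // !cK.
move=> r s t Dr' Ds Dt.
(* Every triangle of values is realized by three points, which [b] or [c] carries to the other
   space. *)
split => [[_ _ _ T]|[_ _ _ T]].
- have [x [y [z [xy1 yz1 xz1]]]] := triangle_realized hD hX Dr' Ds Dt T.
  move: (Dr') (Ds) (Dt); rewrite -xy1 -yz1 -xz1 => D1 D2 D3; rewrite !fE //.
  by split; [exact: fL..|exact: dist_triangle].
- have [x [y [z [xy1 yz1 xz1]]]] := triangle_realized hL hY (fL' _ Dr') (fL' _ Ds) (fL' _ Dt) T.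
  have back u p q : D u -> mdist p q = f u -> mdist (c p) (c q) = u.
    by move=> Du; rewrite -{1}(cK p) -{1}(cK q) => /bd'; rewrite hxy.
  split => //; rewrite -(back _ _ _ Dr' xy1) -(back _ _ _ Ds yz1) -(back _ _ _ Dt xz1).
  exact: dist_triangle.
Qed.

End Reconstruction.

(** * Products of three centralizers of countable index are open *)

Section Category.
Context (R : realType) (Y : metricType R) (y0 : Y).
Hypothesis cY : countable [set: Y].
Local Notation G := (Iso Y).
Implicit Types (A : set G) (E F : seq Y) (g h : G).

(** A pair [E], [g] stands for the basic open set of all isometries that agree with [g] on [E];
    refining the pair shrinks this set. *)
Definition nowhere_dense_set A : Prop := forall E g, exists E' g',
  refines E g E' g' /\ forall h, {in E', h =1 g'} -> ~ A h.

Definition meager A : Prop := exists2 N : nat -> set G,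
  forall n, nowhere_dense_set (N n) & forall h, A h -> exists n, N n h.

Lemma meager_sub A B : (forall h, A h -> B h) -> meager B -> meager A.
Proof. by move=> AB [N N0 BN]; exists N => // h /AB/BN. Qed.

Lemma meager0 : meager set0.
Proof.
exists (fun=> set0) => [n E g|h []]; exists E, g.
by split; [split|move=> h _ []].
Qed.

Lemma nowhere_dense_meager A : nowhere_dense_set A -> meager A.
Proof. by move=> A0; exists (fun=> A) => // h Ah; exists 0%N. Qed.

Lemma meager_bigcup (K : countType) (A : K -> set G) :
  (forall k, meager (A k)) -> meager [set h | exists k, A k h].
Proof.
move=> mA; have /choice[N hN] : forall k, exists N : nat -> set G,
    (forall n, nowhere_dense_set (N n)) /\ forall h, A k h -> exists n, N n h.
  by move=> k; have [N N0 AN] := mA k; exists N.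
exists (fun m => if unpickle m is Some (k, n) then N k n else set0).
  move=> m; case: unpickle => [[k n]|]; first exact: (hN k).1.
  by move=> E g; exists E, g; split; [split|move=> h _ []].
move=> h [k /(hN k).2[n Nh]]; exists (pickle (k, n)).
by rewrite pickleK.
Qed.

Lemma meager_translate A (k : G) : meager A -> meager [set h | A (k^-1 * h)%g].
Proof.
move=> [N N0 AN]; exists (fun n => [set h | N n (k^-1 * h)%g]); last by move=> h /AN.
move=> n E g; have [E' [g' [[s r] h']]] := N0 n E (k^-1 * g)%g.
exists E', (k * g')%g; split.
  by split => // x xE; rewrite /= -(r x xE) /= Iso_inv_funK.
by move=> h hE; apply: h' => x xE /=; rewrite hE // /= Iso_funK.
Qed.

(** The Baire category theorem for the permutation topology: a generic isometry avoids all the sets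
    [N n]. *)
Lemma isometry_group_not_meager : ~ meager setT.
Proof.
move=> [N N0 TN].
have [||||h [_ _ hA]] := @generic_isometry R Y nat y0 cY (fun _ _ => True)
  (fun n E g => forall h, {in E, h =1 g} -> ~ N n h) _ _ _ [::] 1%g.
- move=> x E g _; exists (x :: E), g; split => //; last exact: mem_head.
  by split => // y yE; rewrite inE yE orbT.
- move=> y E g _; exists (Iso_inv g y :: E), g; split => //.
    by split => // z zE; rewrite inE zE orbT.
  by rewrite /= Iso_inv_funK mem_head.
- move=> n E g _; have [E' [g' [r h]]] := N0 n E g.
  by exists E', g'.
- by [].
have [n Nh] := TN h I; have [E [g [_ hE hg]]] := hA n.
exact: hE hg Nh.
Qed.

Definition everywhere A E g : Prop := forall E' g', refines E g E' g' ->
  ~ meager [set h | A h /\ {in E', h =1 g'}].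

Lemma everywhere_refines A E g E' g' : refines E g E' g' ->
  everywhere A E g -> everywhere A E' g'.
Proof. by move=> r eA E2 g2 r2; apply: eA; exact: refines_trans r r2. Qed.

Lemma everywhere_ex A E g : everywhere A E g ->
  exists h, A h /\ {in E, h =1 g}.
Proof.
move=> eA; apply: contrapT => n; apply: (eA E g); first by split.
by apply: meager_sub meager0 => h Ah; apply: n; exists h.
Qed.

(** There are countably many basic open sets, so those on which [A] is meager cover only a meager
    part of [A]. The rest of [A] is not nowhere dense, hence dense in some basic open set, and there
    [A] is nowhere meager. *)
Lemma not_meager_everywhere A : ~ meager A -> exists E g, everywhere A E g.
Proof.
move=> nA; have [en enP] := countable_enum y0 cY.
pose O := [set h | exists E, meager [set h' | A h' /\ {in E, h' =1 h}]].
have mAO : meager [set h | A h /\ O h].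
  pose V (k : seq nat * seq nat) := [set h | A h /\ map h (map en k.1) = map en k.2].
  pose B k := [set h | V k h /\ meager (V k)].
  apply: (@meager_sub _ [set h | exists k, B k h]); last first.
    apply: meager_bigcup => k; have [mV|nV] := pselect (meager (V k)).
      by apply: meager_sub mV => h [].
    by apply: meager_sub meager0 => h [].
  have code E : exists s, map en s = E.
    elim: E => [|x E [s <-]]; first by exists [::].
    by have [n <-] := enP x; exists (n :: s).
  move=> h [Ah [E mE]]; have [s sE] := code E; have [t tE] := code (map h E).
  exists (s, t); split; rewrite /V /= sE tE //.
  apply: meager_sub mE => h' [Ah' e]; split => // x xE.
  by move/eq_in_map: e; apply.
have nAO : ~ meager [set h | A h /\ ~ O h].
  move=> m; apply: nA.
  apply: (@meager_sub _ [set h | exists b : bool, if b then A h /\ O h else A h /\ ~ O h]).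
    by move=> h Ah; have [Oh|nOh] := pselect (O h); [exists true|exists false].
  by apply: (@meager_bigcup bool (fun b =>
    [set h | if b then A h /\ O h else A h /\ ~ O h])) => -[].
have [E [g Eg]] : exists E g, forall E' g', refines E g E' g' ->
    exists h, (A h /\ ~ O h) /\ {in E', h =1 g'}.
  apply: contrapT => n; apply: nAO; apply: nowhere_dense_meager => E g.
  apply: contrapT => n'; apply: n; exists E, g => E' g' r.
  apply: contrapT => n2; apply: n'; exists E', g'; split => // h hE Ah.
  by apply: n2; exists h.
exists E, g => E' g' r m; have [h [[Ah nO] hE]] := Eg _ _ r.
apply: nO; exists E'; apply: meager_sub m => h' [Ah' hh']; split => // x xE.
by rewrite hh' // hE.
Qed.

(** Inverses are controlled as well because a pointwise limit of surjective isometries need not be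
    surjective. *)
Definition agree F g h : Prop :=
  {in F, g =1 h} /\ {in F, Iso_inv g =1 Iso_inv h}.

Lemma agree_trans F g1 g2 g3 : agree F g1 g2 -> agree F g2 g3 -> agree F g1 g3.
Proof.
by move=> [a1 b1] [a2 b2]; split => x xF; [rewrite a1 // a2|rewrite b1 // b2].
Qed.

Lemma agree_limit (F : nat -> seq Y) (g : nat -> G) :
  (forall n, {subset F n <= F n.+1}) -> (forall x, exists n, x \in F n) ->
  (forall n, agree (F n) (g n.+1) (g n)) ->
  exists h, forall n, agree (F n) h (g n).
Proof.
move=> sF cF ag.
have mF m n : (m <= n)%N -> {subset F m <= F n}.
  elim: n => [|n IH]; first by rewrite leqn0 => /eqP ->.
  by rewrite leq_eqVlt => /orP[/eqP -> //|]; rewrite ltnS => /IH s x /s/sF.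
have mg m n : (m <= n)%N -> agree (F m) (g n) (g m).
  elim: n => [|n IH]; first by rewrite leqn0 => /eqP ->; split.
  rewrite leq_eqVlt => /orP[/eqP ->|]; first by split.
  rewrite ltnS => mn; apply: agree_trans (IH mn).
  by have [a b] := ag n; split => x /(mF _ _ mn); [exact: a|exact: b].
have /choice[lev hlev] := cF.
pose h x := g (lev x) x.
have hE n x : x \in F n -> h x = g n x.
  move=> xn; rewrite /h; case: (leqP (lev x) n) => [/mg[a _]|/ltnW/mg[a _]].
    by rewrite a.
  by rewrite a.
have hi : Defs.isometry h.
  move=> x y; pose n := maxn (lev x) (lev y).
  rewrite (hE n x) ?(hE n y) ?Iso_isometry //.
    exact: (mF _ _ (leq_maxr _ _) _ (hlev y)).
  exact: (mF _ _ (leq_maxl _ _) _ (hlev x)).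
have inv n y : y \in F n -> h (Iso_inv (g n) y) = y.
  move=> yn; set x := Iso_inv (g n) y; pose m := maxn n (lev x).
  rewrite (hE m); last exact: (mF _ _ (leq_maxr _ _) _ (hlev x)).
  have [_ b] := mg _ _ (leq_maxl n (lev x)).
  by rewrite /x -(b y yn) -/m Iso_inv_funK.
have hs y : exists x, h x = y by have [n yn] := cF y; exists (Iso_inv (g n) y); exact: inv.
exists (MkIso hi hs) => n; split => x xn; first exact: hE.
apply: (@Iso_inj _ _ (MkIso hi hs)); rewrite Iso_inv_funK.
exact: (esym (inv _ _ xn)).
Qed.

End Category.

Section OpenProduct.
Context (R : realType) (Y : metricType R) (y0 : Y) (a b : Iso Y).
Hypothesis cY : countable [set: Y].
Local Notation G := (Iso Y).
Implicit Types (E F : seq Y) (t : G * G * G).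

Definition centralizes (s g : G) : Prop := forall x, g (s x) = s (g x).

Let C3 t := [/\ centralizes a t.1.1, centralizes b t.1.2 & centralizes a t.2].
Let prod3 t : G := (t.1.1 * t.1.2 * t.2)%g.
Let agree3 F t t' :=
  [/\ agree F t.1.1 t'.1.1, agree F t.1.2 t'.1.2 & agree F t.2 t'.2].
Let piece (k : G) F t0 : set G :=
  [set h | exists t, [/\ C3 t, agree3 F t t0 & h = (k * prod3 t)%g]].

(** Recording the values on [F'] of the three factors and their inverses splits the piece into
    countably many parts. One of them is nonmeager in the given basic open set, hence nowhere meager
    in a smaller one, and any triple of that part serves as [t']. *)
Let refine_piece (k : G) F F' t0 E (g : G) : everywhere (piece k F t0) E g ->
  exists t' E' (g' : G), [/\ C3 t', agree3 F t' t0, refines E g E' g' &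
    everywhere (piece k F' t') E' g'].
Proof.
move=> ev; have [en enP] := countable_enum y0 cY; have /choice[cod codK] := enP.
have codI F1 (g1 g2 : Y -> Y) : map cod (map g1 F1) = map cod (map g2 F1) ->
    {in F1, g1 =1 g2}.
  move=> e x xF; rewrite -(codK (g1 x)) -(codK (g2 x)).
  by move: e; rewrite -!map_comp => /eq_in_map/(_ x xF) /= ->.
pose val t : seq (seq nat) := [seq map cod (map (f : Y -> Y) F') |
  f <- [:: t.1.1 : Y -> Y; Iso_inv t.1.1 : Y -> Y; t.1.2 : Y -> Y;
           Iso_inv t.1.2 : Y -> Y; t.2 : Y -> Y; Iso_inv t.2 : Y -> Y]].
have valI t t' : val t = val t' -> agree3 F' t t'.
  by case=> e1 e2 e3 e4 e5 e6; split; split; exact: codI.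
pose S (w : seq (seq nat)) := [set h : G | {in E, h =1 g} /\
  exists t, [/\ C3 t, agree3 F t t0, h = (k * prod3 t)%g & val t = w]].
have [w nSw] : exists w, ~ meager (S w).
  apply: contrapT => n; apply: (ev E g); first by split.
  apply: (@meager_sub _ _ _ [set h | exists w, S w h]).
    by move=> h [[t [Ct at0 ht]] hE]; exists (val t); split => //; exists t.
  apply: meager_bigcup => w; apply: contrapT => nw; apply: n.
  by exists w.
have [E1 [g1 ev1]] := not_meager_everywhere y0 cY nSw.
have [h [[hE [t' [Ct' at' ht' vt']]] hE1]] := everywhere_ex ev1.
exists t', (E ++ E1), h; split => //.
  by split => x xE; rewrite ?hE // mem_cat xE.
have r1 : refines E1 g1 (E ++ E1) h.
  by split => x xE; rewrite ?hE1 // mem_cat xE orbT.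
move=> E2 g2 r2 m; apply: (everywhere_refines r1 ev1 r2); apply: meager_sub m.
move=> h' [[_ [t [Ct _ e vt]]] h'2]; split => //; exists t; split => //.
by apply: valI; rewrite vt vt'.
Qed.

Let cen_limit (s h : G) (F : nat -> seq Y) (g : nat -> G) :
  (forall m n, (m <= n)%N -> {subset F m <= F n}) -> (forall x, exists n, x \in F n) ->
  (forall n, centralizes s (g n)) -> (forall n, agree (F n) h (g n)) -> centralizes s h.
Proof.
move=> mF cF cg hg x; have [m xm] := cF x; have [n sn] := cF (s x).
have [hx _] := hg (maxn m n).
rewrite !hx ?cg //; first exact: (mF _ _ (leq_maxl m n) _ xm).
exact: (mF _ _ (leq_maxr m n) _ sn).
Qed.

(* H is nowhere meager on some basic open set [E, g]. For k fixing g E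
   pointwise the same holds for k H, and refining pieces of H and of k H in
   parallel produces two products with c d e = k c' d' e', whence k is in H. *)
Lemma triple_product_open (H : set G) : is_subgroup H ->
  (forall g, H g <-> exists c d e : G,
     [/\ centralizes a c, centralizes b d, centralizes a e & g = (c * d * e)%g]) ->
  (exists r : nat -> G, forall g, exists n, H ((r n)^-1 * g)%g) ->
  exists F, supports F H.
Proof.
move=> hH HP [r hr].
have Ht t : C3 t -> H (prod3 t).
  by move=> [c1 c2 c3]; apply/HP; exists t.1.1, t.1.2, t.2.
have nH : ~ meager H.
  move=> mH; apply: (isometry_group_not_meager y0 cY).
  apply: (@meager_sub _ _ _ [set g | exists n, H ((r n)^-1 * g)%g]) => [g _|].
    exact: hr.
  apply: (@meager_bigcup _ _ nat (fun n => [set g | H ((r n)^-1 * g)%g])) => n.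
  exact: meager_translate.
have [E [g ev]] := not_meager_everywhere y0 cY nH.
exists (map g E) => k kE.
pose t1 : G * G * G := (1, 1, 1)%g.
have ev1 : everywhere (piece 1%g [::] t1) E g.
  move=> E' g' rr m; apply: (ev E' g' rr); apply: meager_sub m => h [Hh hE]; split => //.
  have [c [d [e [c1 c2 c3 ->]]]] := (HP h).1 Hh; exists (c, d, e).
  by split; [split|split; split|rewrite mul1g].
have evk : everywhere (piece k [::] t1) E g.
  move=> E' g' rr m; apply: (ev E' (k^-1 * g')%g).
    case: rr => s rr; split => // x xE; rewrite /= -rr //.
    by apply: (@Iso_inj _ _ k); rewrite Iso_inv_funK kE // map_f.
  have := meager_translate (k^-1)%g m; apply: meager_sub => h [Hh hE] /=.
  rewrite invgK; split => [|x xE]; last first.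
    by have /= -> := hE x xE; exact: (Iso_funK (k^-1)%g).
  have [c [d [e [c1 c2 c3 ->]]]] := (HP h).1 Hh; exists (c, d, e).
  by split; [split|split; split|].
have [en enP] := countable_enum y0 cY.
(* A state holds a finite set, a triple for [H], a triple for [k H], and one basic open set in which
   both pieces are nowhere meager. Sharing this set is what makes the two limit products equal. *)
pose St := (seq Y * (G * G * G) * (G * G * G) * (seq Y * G))%type.
pose Inv (s : St) := [/\ C3 s.1.1.2, C3 s.1.2, everywhere (piece 1%g s.1.1.1 s.1.1.2) s.2.1 s.2.2,
  everywhere (piece k s.1.1.1 s.1.2) s.2.1 s.2.2 & {subset s.1.1.1 <= s.2.1}].
pose s0 : St := ([::], t1, t1, (E, g)).
have C1 : C3 t1 by split.
have I0 : Inv s0 by split.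
pose Q (n : nat) (s s' : St) := [/\ s'.1.1.1 = en n :: s.1.1.1,
  agree3 s.1.1.1 s'.1.1.2 s.1.1.2 & agree3 s.1.1.1 s'.1.2 s.1.2].
have step n s : Inv s -> exists s', Inv s' /\ Q n s s'.
  case: s => [[[F u] v] [E1 g1]] [/= Cu Cv eu ek sF].
  have [u' [E2 [g2 [Cu' au r2 eu']]]] := refine_piece (en n :: F) eu.
  have [v' [E3 [g3 [Cv' av r3 ek']]]] := refine_piece (en n :: F) (everywhere_refines r2 ek).
  have r4 : refines E3 g3 (en n :: F ++ E3) g3.
    by split => // x xE; rewrite inE mem_cat xE !orbT.
  exists (en n :: F, u', v', (en n :: F ++ E3, g3)); split; last by split.
  split => //=.
  - exact: everywhere_refines (refines_trans r3 r4) eu'.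
  - exact: everywhere_refines r4 ek'.
  - by move=> x; rewrite !inE mem_cat => /orP[->//|->]; rewrite orbT.
have /choice[f hf] : forall p : nat * {s | Inv s}, 
    exists s' : {s | Inv s}, Q p.1 (sval p.2) (sval s').
  move=> [n [s Is]]; have [s' [Is' q]] := step n s Is.
  by exists (exist _ s' Is').
pose fix sq n : {s | Inv s} := if n is m.+1 then f (m, sq m) else exist _ s0 I0.
pose F n := (sval (sq n)).1.1.1; pose u n := (sval (sq n)).1.1.2; pose v n := (sval (sq n)).1.2.
have sF n : {subset F n <= F n.+1}.
  by have [/= e _ _] := hf (n, sq n); move=> x xF; rewrite /F /= e inE xF orbT.
have cF x : exists n, x \in F n.
  have [n <-] := enP x; exists n.+1; have [/= e _ _] := hf (n, sq n).
  by rewrite /F /= e mem_head.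
have mF m n : (m <= n)%N -> {subset F m <= F n}.
  elim: n => [|n IH]; first by rewrite leqn0 => /eqP ->.
  by rewrite leq_eqVlt => /orP[/eqP -> //|]; rewrite ltnS => /IH s x /s/sF.
have au n : agree3 (F n) (u n.+1) (u n) by have [] := hf (n, sq n).
have av n : agree3 (F n) (v n.+1) (v n) by have [] := hf (n, sq n).
have lim3 (w : nat -> G * G * G) : (forall n, C3 (w n)) ->
    (forall n, agree3 (F n) (w n.+1) (w n)) ->
    exists2 t, C3 t & forall n, agree3 (F n) t (w n).
  move=> Cw aw.
  have [|c hc] := agree_limit sF cF (g := fun n => (w n).1.1).
    by move=> n; case: (aw n).
  have [|d hd] := agree_limit sF cF (g := fun n => (w n).1.2).
    by move=> n; case: (aw n).
  have [|e he] := agree_limit sF cF (g := fun n => (w n).2).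
    by move=> n; case: (aw n).
  exists (c, d, e); last by move=> n; split.
  by split; [apply: (cen_limit mF cF _ hc)|apply: (cen_limit mF cF _ hd)|
    apply: (cen_limit mF cF _ he)] => n; case: (Cw n).
have Is n : Inv (sval (sq n)) by exact: svalP.
have [tu Cu hu] : exists2 t, C3 t & forall n, agree3 (F n) t (u n).
  by apply: lim3 => // n; case: (Is n).
have [tv Cv hv] : exists2 t, C3 t & forall n, agree3 (F n) t (v n).
  by apply: lim3 => // n; case: (Is n).
(* Once [F n] contains x and its intermediate images, the product at x is computed by any triple
   that agrees with [w n] there, in particular by one whose product lies in the n-th basic open
   set. *)
have pieceE t w (k' : G) n x : (forall n, agree3 (F n) t (w n)) ->
    [/\ x \in F n, t.2 x \in F n & t.1.2 (t.2 x) \in F n] ->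
    everywhere (piece k' (F n) (w n)) (sval (sq n)).2.1 (sval (sq n)).2.2 ->
    (k' * prod3 t)%g x = (sval (sq n)).2.2 x.
  move=> htw [x1 x2 x3] /everywhere_ex[h [[t' [Ct' at' ->]] hE]].
  case: (Is n) => _ _ _ _ /(_ x x1) xE; rewrite -hE //=.
  have [[p1 _] [p2 _] [p3 _]] := htw n; have [[q1 _] [q2 _] [q3 _]] := at'.
  have e3 : t'.2 x = t.2 x by rewrite q3 // p3.
  have e2 : t'.1.2 (t'.2 x) = t.1.2 (t.2 x) by rewrite e3 q2 // p2.
  by rewrite /prod3 /= e2 q1 // p1.
have ku : prod3 tu = (k * prod3 tv)%g.
  apply: Iso_eq => x.
  have [n hn] : exists n, {subset [:: x; tu.2 x; tu.1.2 (tu.2 x); tv.2 x; tv.1.2 (tv.2 x)] <= F n}.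
    elim: [:: _; _; _; _; _] => [|y l [n hn]]; first by exists 0%N.
    have [m ym] := cF y; exists (maxn m n) => z; rewrite inE => /orP[/eqP ->|/hn].
      exact: (mF _ _ (leq_maxl m n) _ ym).
    exact: (mF _ _ (leq_maxr m n)).
  case: (Is n) => _ _ e1 e2 _.
  rewrite (pieceE tv v k n x hv _ e2); last by split; apply: hn; rewrite !inE eqxx ?orbT.
  rewrite -(pieceE tu u 1%g n x hu _ e1); last by split; apply: hn; rewrite !inE eqxx ?orbT.
  by rewrite mul1g.
have -> : k = (prod3 tu * (prod3 tv)^-1)%g by rewrite ku mulgK.
by case: hH => _ HM HV; apply: HM; [exact: Ht|apply: HV; exact: Ht].
Qed.

End OpenProduct.

(** * Extending a total and a partial involution *)

Lemma pigeonhole (T : finType) (f : nat -> T) : exists i j, (i < j)%N /\ f i = f j.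
Proof.
apply: contrapT => n.
have inj : injective (fun i : 'I_#|T|.+1 => f i).
  move=> i j fij; apply: val_inj; apply: contrapT => ij; apply: n.
  by case: (ltngtP i j) => // ?; [exists i, j|exists j, i].
by have := leq_card _ inj; rewrite card_ord ltnn.
Qed.

Section ExtendInvolutions.
Context (R : realType) (D : set R) (r0 : R).
Hypotheses (hD : distance_value_set D) (Dr0 : D r0).
Context (P : finType) (d : P -> P -> R).
Hypotheses (hd : pmet d) (vd : valued D d) (dpos : forall p q, d p q = 0 -> p = q).
Context (t s : P -> P) (Dm : pred P) (o : P).
Hypotheses (tK : involutive t) (ti : forall p q, d (t p) (t q) = d p q).
Hypotheses (sD : forall p, Dm p -> Dm (s p)) (sK : forall p, Dm p -> s (s p) = p).
Hypothesis si : forall p q, Dm p -> Dm q -> d (s p) (s q) = d p q.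
Hypotheses (Do : Dm o) (to : t o = o) (so : s o = o).
Hypotheses (tfix : forall p, t p = p -> p = o) (sfix : forall p, Dm p -> s p = p -> p = o).

Let d0 p : d p p = 0. Proof. by case: hd. Qed.
Let ds p q : d p q = d q p. Proof. by case: hd. Qed.
Let dt p q r : d p r <= d p q + d q r. Proof. by case: hd. Qed.
Let dge p q : 0 <= d p q. Proof. exact: pmet_ge0. Qed.

Let th x := t (s x).

Let th_iso x y : Dm x -> Dm y -> d (th x) (th y) = d x y.
Proof. by move=> Dx Dy; rewrite /th ti si. Qed.

(* Glue copies of P indexed by the integers, identifying x in the i-th copy with
   [th x] in the next one for x in Dm. Then [lam k p q] is the path distance
   from p in the copy 0 to q in the copy k. *)
Fixpoint lam (k : nat) (p q : P) : R :=
  if k is j.+1 then minf Dm o (fun x => lam j p x + d (th x) q) else d p q.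

Let lam_le k p q x : Dm x -> lam k.+1 p q <= lam k p x + d (th x) q.
Proof. by move=> Dx; exact: (@minf_le R P Dm o (fun x => lam k p x + d (th x) q) Do x Dx). Qed.

Let lam_ex k p q : exists2 x, Dm x & lam k.+1 p q = lam k p x + d (th x) q.
Proof. exact: (@minf_ex R P Dm o (fun x => lam k p x + d (th x) q) Do). Qed.

Let lam_adm k p q : admissible D (lam k p q).
Proof.
elim: k q => [|k IH] q; first exact: valued_admissible.
have [x Dx ->] := lam_ex k p q; apply: admissibleD => //; exact: valued_admissible.
Qed.

Let lam_ge0 k p q : 0 <= lam k p q.
Proof. exact: admissible_ge0. Qed.

Let lam_r k p x q : lam k p q <= lam k p x + d x q.
Proof.
case: k => [|k]; first exact: dt.
have [y Dy ->] := lam_ex k p x; have := lam_le k p q Dy; have := dt (th y) x q; lra.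
Qed.

Let lam_comp k l p x q : lam (k + l) p q <= lam k p x + lam l x q.
Proof.
elim: l q => [|l IH] q; first by rewrite addn0; exact: lam_r.
have [y Dy ->] := lam_ex l x q; rewrite addnS.
by have := lam_le (k + l) p q Dy; have := IH y; lra.
Qed.

Let lam_l k p x q : lam k p q <= d p x + lam k x q.
Proof. exact: (lam_comp 0). Qed.

Let lam_split k l p q : exists x, lam k p x + lam l x q <= lam (k + l) p q.
Proof.
elim: l q => [|l IH] q; first by exists q; rewrite addn0 /= d0 addr0.
have [y Dy e] := lam_ex (k + l) p q; have [x hx] := IH y.
exists x; rewrite addnS e; have := lam_le l x q Dy; lra.
Qed.

(** As [th] is isometric on [Dm], the last steps of a path from [p] and of one from [q] that meet at
    [x] can be removed in pairs. *)
Let lam_back k l p q x : lam k p q <= lam (k + l) p x + lam l q x.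
Proof.
elim: l x => [|l IH] x; first by rewrite addn0 /= ds; exact: lam_r.
rewrite addnS; have [y Dy ->] := lam_ex (k + l) p x; have [z Dz ->] := lam_ex l q x.
have := IH z; have := lam_r (k + l) p y z; have := th_iso Dy Dz.
by have := dt (th y) x (th z); rewrite (ds x); lra.
Qed.

(** [t] reflects the line of copies: since th (s x) = t x and s x = t (th x), a step from x to
    [th x] becomes a step from [t (th x)] to [t x]. *)
Let lam_rev_le k p q : lam k (t q) (t p) <= lam k p q.
Proof.
elim: k q => [|k IH] q; first by rewrite /= ti ds.
have [x Dx ->] := lam_ex k p q.
have := lam_comp 1 k (t q) (t x) (t p); rewrite add1n; have := IH x.
have := lam_le 0 (t q) (t x) (sD Dx).
by rewrite /th sK // d0 addr0 /= -ti tK (ds q) -/(th x); lra.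
Qed.

Let lam_rev k p q : lam k (t q) (t p) = lam k p q.
Proof.
apply/eqP; rewrite eq_le lam_rev_le /=.
by have := lam_rev_le k (t q) (t p); rewrite !tK.
Qed.

Let lam_forth k l p q x : lam k p q <= lam l x p + lam (k + l) x q.
Proof.
have := lam_back k l (t q) (t p) (t x); rewrite !lam_rev; lra.
Qed.

(** [th] fixes [o], so [o] is one common point of all copies. *)
Let lam_bound k p q : lam k p q <= d p o + d o q.
Proof.
elim: k q => [|k IH] q; first exact: dt.
by have := lam_le k p q Do; have := IH o; rewrite /th so to d0; lra.
Qed.

Let sums : nat -> seq R := fix sums r := if r is j.+1 then
  sums j ++ [seq u + v | u <- sums j, v <- [seq d x.1 x.2 | x <- enum {: P * P}]]
  else [:: 0].

Let lam_finite : exists W : seq R, forall k p q, lam k p q \in W.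
Proof.
have [e e0 he] : exists2 e, 0 < e & forall p q, d p q = 0 \/ e <= d p q.
  have : [seq d x.1 x.2 | x <- enum {: P * P} & d x.1 x.2 != 0] = [::] \/
         [seq d x.1 x.2 | x <- enum {: P * P} & d x.1 x.2 != 0] != [::].
    by case: (_ =P [::]) => [->|]; [left|right].
  have inl p q : d p q != 0 -> d p q \in
      [seq d x.1 x.2 | x <- enum {: P * P} & d x.1 x.2 != 0].
    move=> n0; apply/mapP; exists (p, q) => //.
    by rewrite mem_filter n0 mem_enum.
  case=> [E|/(seq_argmin id)[e ein emin]].
    exists 1; rewrite ?ltr01 // => p q; left; apply/eqP; apply: contraT => /inl.
    by rewrite E.
  exists e.
    move/mapP: ein => [[p q]]; rewrite mem_filter => /andP[n0 _] ->.
    by rewrite lt_def n0 dge.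
  by move=> p q; have [|n0] := eqVneq (d p q) 0; [left|right; exact/emin/inl].
have [B hB] : exists B, forall p q, d p q <= B.
  have [|x _ hx] := seq_argmin (fun x : P * P => - d x.1 x.2) (s := enum {: P * P}).
    by apply/eqP => E; have := mem_enum {: P * P} (o, o); rewrite E.
  by exists (d x.1 x.2) => p q; have := hx (p, q); rewrite mem_enum => /(_ isT) /=; lra.
have mono r r' : (r <= r')%N -> {subset sums r <= sums r'}.
  elim: r' => [|r' IH]; first by rewrite leqn0 => /eqP ->.
  rewrite leq_eqVlt => /orP[/eqP -> //|]; rewrite ltnS => /IH h x /h /= xs.
  by rewrite mem_cat xs.
have key k p q : exists r, lam k p q \in sums r /\ r%:R * e <= lam k p q.
  have add r v p' q' : v \in sums r -> r%:R * e <= v ->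
      exists r', v + d p' q' \in sums r' /\ r'%:R * e <= v + d p' q'.
    move=> vr rv; case: (he p' q') => [->|ep]; first by rewrite addr0; exists r.
    exists r.+1; split; last by rewrite -natr1 mulrDl mul1r lerD.
    rewrite /= mem_cat; apply/orP; right; apply/allpairsP; exists (v, d p' q').
    by split => //=; apply/mapP; exists (p', q'); rewrite // mem_enum.
  elim: k q => [|k IH] q.
    by rewrite /= -[d p q]add0r; apply: (add 0%N); rewrite ?mul0r //= mem_head.
  have [x Dx ->] := lam_ex k p q; have [r [vr rv]] := IH x.
  exact: add vr rv.
have [N hN] : exists N : nat, (B + B) / e < N%:R.
  exists (Num.bound ((B + B) / e)); apply: archi_boundP.
  by rewrite divr_ge0 ?(ltW e0) // addr_ge0 // (le_trans (dge o o)) // hB.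
exists (sums N) => k p q; have [r [vr rv]] := key k p q.
apply: mono vr; rewrite -(ler_nat R); apply: ltW; apply: le_lt_trans hN.
rewrite ler_pdivlMr //; apply: le_trans rv _.
by apply: le_trans (lam_bound _ _ _) _; exact: lerD.
Qed.

(** With finitely many values, two of the functions [lam k] coincide, and composition makes the
    sequence eventually periodic. A multiple of the period beyond the preperiod is idempotent; b(a +
    1) is one. *)
Let lam_idempotent : exists2 n, (0 < n)%N & forall p q, lam (n + n) p q = lam n p q.
Proof.
have [W hW] := lam_finite.
pose code k := [ffun x : P * P => inord (index (lam k x.1 x.2) W) : 'I_(size W).+1].
have codeI k l : code k = code l -> forall p q, lam k p q = lam l p q.
  move=> e p q; have := congr1 (fun f : {ffun P * P -> 'I_(size W).+1} => val (f (p, q))) e.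
  rewrite !ffunE /= !inordK ?ltnS ?index_size // => /(congr1 (nth 0 W)).
  by rewrite !nth_index.
have [a [c [ac /codeI e]]] := pigeonhole code.
have [b b0 cE] : exists2 b, (0 < b)%N & c = (a + b)%N.
  by exists (c - a)%N; [rewrite subn_gt0|rewrite subnKC // ltnW].
have shift m p q : lam (a + b + m) p q = lam (a + m) p q.
  apply/eqP; rewrite eq_le; apply/andP; split.
    have [x hx] := lam_split a m p q; apply: le_trans hx; rewrite e -cE.
    exact: lam_comp.
  have [x hx] := lam_split (a + b) m p q; apply: le_trans hx; rewrite -cE -e.
  exact: lam_comp.
have shifts j m p q : lam (a + b * j + m) p q = lam (a + m) p q.
  elim: j m => [|j IH] m; first by rewrite muln0 addn0.
  by rewrite mulnS addnA -addnA shift addnA IH.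
exists (b * a.+1)%N; first by rewrite muln_gt0 b0.
move=> p q; have an : (a <= b * a.+1)%N.
  by apply: leq_trans (leqnSn a) _; rewrite leq_pmull.
have := shifts a.+1 (b * a.+1 - a)%N p q.
rewrite (subnKC an) => <-; congr lam.
by rewrite -addnA [(b * _ + (_ - _))%N]addnC addnA subnKC.
Qed.

(* For an idempotent e = lam n of the (min, +) algebra, a distance e p q splits
   through a point x with e x x = 0, and then d p x <= e p x + e x x. *)
Let lam_far : exists2 n, (0 < n)%N & forall p q, d p q <= lam n p q.
Proof.
have [n n0 idem] := lam_idempotent; exists n => // p q.
pose e := lam n.
have etri x y z : e x z <= e x y + e y z by rewrite /e -idem; exact: lam_comp.
have /choice[g hg] : forall x, exists y, e p y + e y x <= e p x.
  by move=> x; have [y hy] := lam_split n n p x; exists y; rewrite /e -(idem p x).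
pose x i := iter i g q.
have chain i k : e p (x (i + k.+1)%N) + e (x (i + k.+1)%N) (x i) <= e p (x i).
  elim: k => [|k IH]; first by rewrite addn1; exact: hg.
  have := hg (x (i + k.+1)%N); rewrite -[g _]/(x (i + k.+1).+1) -addnS => h.
  by have := etri (x (i + k.+2)%N) (x (i + k.+1)%N) (x i); lra.
have [i [j [ij xij]]] := pigeonhole x.
(* When the sequence of split points returns to [x i], the chain inequality leaves nothing for the
   loop. *)
have loop : e (x i) (x i) = 0.
  have := chain i (j - i.+1)%N; rewrite addnS -addSn subnKC // -xij.
  by have := lam_ge0 n (x i) (x i); rewrite -/e; lra.
have dp : d p (x i) <= e p (x i).
  by have := lam_back 0 n p (x i) (x i); rewrite add0n -/e loop addr0.
case: i ij xij loop dp => [|i] ij xij loop dp; first exact: dp.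
have dq : d (x i.+1) q <= e (x i.+1) q.
  by have := lam_forth 0 n (x i.+1) q (x i.+1); rewrite add0n -/e loop add0r.
by have := chain 0%N i; have := dt p (x i.+1) q; rewrite -/e add0n /= -/(x i.+1); lra.
Qed.

(** The hypothesis says that [p] in copy 0 is fixed by the reflection exchanging the copies 0 and m.
    For m = 0 and m = 1 this is a fixed point of [t] or of [s]; for larger m, one step is stripped
    off at each end, and m drops by 2. *)
Let lam_fixed m p : lam m p (t p) = 0 -> p = o.
Proof.
have [k] := ubnP m; elim: k m p => // k IH [|[|m]] p lt_m.
- by move=> /= /dpos e; apply: tfix.
- have [x Dx ->] := lam_ex 0 p (t p) => /= h.
  have px : p = x by apply: dpos; have := dge p x; have := dge (th x) (t p); lra.
  have : d (th x) (t p) = 0 by have := dge p x; have := dge (th x) (t p); lra.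
  by rewrite /th ti => /dpos sx; apply: sfix; rewrite px // {1}sx px.
- have [x1] := lam_split 1 m.+1 p (t p); rewrite add1n => h h0.
  have := lam_ge0 1 p x1; have := lam_ge0 m.+1 x1 (t p) => g1 g2.
  have /eqP : lam 1 p x1 = 0 by lra.
  have [x Dx ->] := lam_ex 0 p x1 => /= /eqP e1.
  have px : p = x by apply: dpos; have := dge p x; have := dge (th x) x1; lra.
  have xx1 : th x = x1 by apply: dpos; have := dge p x; have := dge (th x) x1; lra.
  have /eqP : lam m.+1 x1 (t p) = 0 by lra.
  have [y Dy ->] := lam_ex m x1 (t p) => /eqP e2.
  have ly := lam_ge0 m x1 y; have dy := dge (th y) (t p).
  have : d (th y) (t p) = 0 by lra.
  rewrite /th ti => /dpos sy.
  have x1o : x1 = o.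
    have yx : t x1 = y by rewrite -xx1 /th tK -px -sy sK.
    by apply: (IH m); rewrite ?yx; [exact: ltnW|lra].
  have : s p = o by rewrite -(tK (s p)) px -/(th x) xx1 x1o to.
  by move=> sp; rewrite -(sK (p := p)) ?sp // px.
Qed.

(* The line of copies of P can be closed up to a cycle of length n as soon as
   d <= lam n; the two involutions become reflections of the cycle. *)
Lemma involutions_extend : exists (J : finType) (rho : J -> J -> R)
    (T S : J -> J) (i : P -> J),
  [/\ pmet rho, valued D rho, involutive T & involutive S] /\
  [/\ forall u v, rho (T u) (T v) = rho u v, forall u v, rho (S u) (S v) = rho u v,
      injective i, forall p q, rho (i p) (i q) = d p q &
      (forall p, T (i p) = i (t p)) /\ (forall p, Dm p -> rho (S (i p)) (i (s p)) = 0)] /\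
  (forall u, rho u (T u) = 0 \/ rho u (S u) = 0 -> rho u (i o) = 0).
Proof.
have [[//|n] _ far] := lam_far.
(* A full turn around the cycle of length n + 1 never shortens a path. *)
have farD r p q : lam r p q <= lam (n.+1 + r) p q.
  have [x hx] := lam_split n.+1 r p q; apply: le_trans hx.
  by have := lam_l r p x q; have := far p x; lra.
have farM c r p q : lam r p q <= lam (n.+1 * c + r) p q.
  elim: c => [|c IH]; first by rewrite muln0.
  by apply: le_trans IH _; rewrite mulnS -addnA; exact: farD.
pose I := 'I_n.+1; pose u : I := inZp 1.
have uE k : val (u *+ k) = (k %% n.+1)%N.
  by elim: k => [|k IH]; rewrite ?mod0n // mulrS /= IH modnDm.
have uval (z : I) : u *+ val z = z by apply: val_inj; rewrite uE modn_small // ltn_ord.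
have un : u *+ n.+1 = 0 by apply: val_inj; rewrite uE modnn.
pose J : finType := (I * P)%type.
(* [lam] only walks forward, so the way back from x to y is measured from y to x. *)
pose raw (x y : J) : R := let m := val (y.1 - x.1) in
  Num.min (lam m x.2 y.2) (lam (n.+1 - m) y.2 x.2).
have rawF (x y : J) k : x.1 + u *+ k = y.1 -> raw x y <= lam k x.2 y.2.
  move=> e; have m : val (y.1 - x.1) = (k %% n.+1)%N by rewrite -e addrC addKr uE.
  rewrite /raw m ge_min; apply/orP; left.
  by rewrite {2}(divn_eq k n.+1) mulnC; exact: farM.
have rawB (x y : J) k : y.1 + u *+ k = x.1 -> raw x y <= lam k y.2 x.2.
  move=> e; have lk : lam (k %% n.+1) y.2 x.2 <= lam k y.2 x.2.
    by rewrite {2}(divn_eq k n.+1) mulnC; exact: farM.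
  have ku : u *+ (k %% n.+1) = x.1 - y.1.
    by apply: val_inj; rewrite uE modn_mod -uE -e addrC addKr.
  have kn := ltn_pmod k (ltn0Sn n); rewrite /raw ge_min.
  have [k0|k0] := posnP (k %% n.+1).
    move: ku; rewrite k0 mulr0n => /esym/eqP; rewrite subr_eq0 => /eqP xy.
    by move: lk; rewrite k0 xy subrr /= ds => ->.
  have -> : val (y.1 - x.1) = (n.+1 - k %% n.+1)%N.
    rewrite -(opprB x.1) -ku; have -> : - (u *+ (k %% n.+1)) = u *+ (n.+1 - k %% n.+1).
      by rewrite mulrnBr ?un ?sub0r // ltnW.
    by rewrite uE modn_small // ltn_subrL k0.
  by rewrite subKn ?lk ?orbT // ltnW.
have rawP (x y : J) : exists k, (x.1 + u *+ k = y.1 /\ raw x y = lam k x.2 y.2) \/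
    (y.1 + u *+ k = x.1 /\ raw x y = lam k y.2 x.2).
  rewrite /raw; set m := val (y.1 - x.1).
  have um : u *+ m = y.1 - x.1 by exact: uval.
  have [_|_] := leP (lam m x.2 y.2) _.
    by exists m; left; rewrite um addrC subrK.
  exists (n.+1 - m)%N; right; split => //.
  rewrite mulrnBr; last by rewrite ltnW // ltn_ord.
  by rewrite un sub0r um opprB addrC subrK.
have raw_ge0 x y : 0 <= raw x y by have [k [[_ ->]|[_ ->]]] := rawP x y.
have raw_sym_le x y : raw x y <= raw y x.
  by have [k [[e ->]|[e ->]]] := rawP y x; [exact: rawB|exact: rawF].
have rawm : pmet raw.
  split => [x|x y|x y z].
  - apply/eqP; rewrite eq_le raw_ge0 andbT -(d0 x.2).
    by apply: (rawF x x 0%N); rewrite mulr0n addr0.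
  - by apply/eqP; rewrite eq_le !raw_sym_le.
  - have [k [[e1 ->]|[e1 ->]]] := rawP x y; have [l [[e2 ->]|[e2 ->]]] := rawP y z.
    + by apply: le_trans (lam_comp k l _ _ _); apply: rawF; rewrite mulrnDr addrA e1.
    + have [lk|/ltnW kl] := leqP l k.
        apply: le_trans (rawF x z (k - l)%N _) _.
          by rewrite mulrnBr // addrA e1 -e2 addrK.
        by have := lam_back (k - l) l x.2 z.2 y.2; rewrite subnK.
      apply: le_trans (rawB x z (l - k)%N _) _.
        by rewrite mulrnBr // addrA e2 -e1 addrK.
      by have := lam_back (l - k) k z.2 x.2 y.2; rewrite subnK // addrC.
    + have [lk|/ltnW kl] := leqP k l.
        apply: le_trans (rawF x z (l - k)%N _) _.
          by rewrite mulrnBr // -e1 -e2 addrACA subrr addr0.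
        by have := lam_forth (l - k) k x.2 z.2 y.2; rewrite subnK.
      apply: le_trans (rawB x z (k - l)%N _) _.
        by rewrite mulrnBr // -e1 -e2 addrACA subrr addr0.
      by have := lam_forth (k - l) l z.2 x.2 y.2; rewrite subnK // addrC.
    + rewrite addrC; apply: le_trans (lam_comp l k _ _ _); apply: rawB.
      by rewrite mulrnDr addrA e2 e1.
have rawa x y : admissible D (raw x y) by have [k [[_ ->]|[_ ->]]] := rawP x y.
(* On copy 0, [refl 0] is [t], while [refl u] sends p to t p in copy 1; that point is glued to s p
   in copy 0 because th (s p) = t p. *)
pose refl (c : I) (x : J) : J := (c - x.1, t x.2).
have reflK c : involutive (refl c).
  by move=> [i p]; rewrite /refl /= tK opprB addrCA subrr addr0.
have refl_le c x y : raw (refl c x) (refl c y) <= raw x y.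
  have [k [[e ->]|[e ->]]] := rawP x y; rewrite -lam_rev.
    by apply: rawB; rewrite /= -e opprD addrA subrK.
  by apply: rawF; rewrite /= -e opprD addrA subrK.
have refl_iso c x y : raw (refl c x) (refl c y) = raw x y.
  apply/eqP; rewrite eq_le refl_le /=.
  by have := refl_le c (refl c x) (refl c y); rewrite !reflK.
have raw_base p q : raw (0, p) (0, q) = d p q.
  apply/eqP; rewrite eq_le; apply/andP; split.
    by apply: (rawF (0, p) (0, q) 0%N); rewrite mulr0n addr0.
  have mult k a b : u *+ k = 0 -> d a b <= lam k a b.
    move=> /(congr1 val); rewrite uE /= => k0.
    by rewrite (divn_eq k n.+1) k0 mulnC; exact: (farM _ 0%N).
  have [k [[/= e ->]|[/= e ->]]] := rawP (0, p) (0, q); move: e; rewrite add0r => /mult //.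
  by rewrite ds.
have refl_fix c x : raw x (refl c x) = 0 -> raw x (0, o) = 0.
  move=> h; have xo : x.2 = o.
    have [k [[_ e]|[_ e]]] := rawP x (refl c x); rewrite h /= in e.
      by apply: (@lam_fixed k); rewrite -e.
    rewrite -(tK x.2) (@lam_fixed k (t x.2)) ?to // tK -e //.
  apply/eqP; rewrite eq_le raw_ge0 andbT.
  apply: le_trans (rawF x (0, o) (val (- x.1)) _) _; first by rewrite uval subrr.
  by have := lam_bound (val (- x.1)) x.2 o; rewrite xo d0 addr0.
exists J, (fun x y => vtrunc D (raw x y)), (refl 0), (refl u), (fun p => (0, p)).
split; [split => //|split; [split|]].
- exact: (vtrunc_pmet hD Dr0).
- by apply: vtrunc_valued => //; exists r0.
- by move=> x y; rewrite refl_iso.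
- by move=> x y; rewrite refl_iso.
- by move=> p q [].
- by move=> p q; rewrite raw_base; exact: (vtrunc_val hD Dr0).
- split => p; first by rewrite /refl /= subr0.
  move=> Dp; suff -> : raw (refl u (0, p)) (0, s p) = 0 by exact: (vtrunc0 hD Dr0).
  apply/eqP; rewrite eq_le raw_ge0 andbT.
  apply: le_trans (rawB _ (0, s p) 1%N _) _; first by rewrite /= add0r subr0.
  have := lam_le 0 (s p) (t p) (sD Dp).
  by rewrite /th sK // /= !d0 addr0.
- move=> x h; suff -> : raw x (0, o) = 0 by exact: (vtrunc0 hD Dr0).
  by case: h => /(vtrunc_eq0 hD Dr0 (raw_ge0 _ _)); exact: refl_fix.
Qed.

End ExtendInvolutions.

(** * Generic involutions *)

Section SwapAmalgam.
Context (R : realType) (D : set R) (r0 : R).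
Hypotheses (hD : distance_value_set D) (Dr0 : D r0).
Context (J K : finType) (rho : J -> J -> R) (i : K -> J) (s : K -> K) (k0 : K).
Hypotheses (hr : pmet rho) (vr : valued D rho) (sK : involutive s).
Hypothesis si : forall a b, rho (i (s a)) (i (s b)) = rho (i a) (i b).

Definition swap (x : J + J) : J + J :=
  match x with inl p => inr p | inr p => inl p end.

(** Gluing a in one copy of [J] to s a in the other makes the exchange of the copies an involution
    extending [s]. The copies meet only along [K], so no point outside [K] becomes fixed. *)
Lemma swap_amalgamation : exists rho' : (J + J)%type -> (J + J)%type -> R,
  [/\ pmet rho', valued D rho', forall p q, rho' (inl p) (inl q) = rho p q,
      forall a, rho' (inl (i a)) (inr (i (s a))) = 0
    & forall x y, rho' (swap x) (swap y) = rho' x y] /\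
  (forall p q, rho' (inl p) (inr q) = 0 ->
     exists a, rho p (i a) = 0 /\ rho (i (s a)) q = 0).
Proof.
have h12 a b : rho (i a) (i b) = rho (i (s a)) (i (s b)) by rewrite si.
pose am := amalgam D rho rho i (fun a => i (s a)) k0.
exists am; split; [split|].
- exact: (amalgam_pmet hD Dr0 hr hr k0 h12).
- exact: (amalgam_valued hD Dr0 vr vr i (fun a => i (s a)) k0).
- exact: (amalgam_inl hD Dr0 rho vr i (fun a => i (s a)) k0).
- exact: (amalgam_glue hD Dr0 hr hr k0 h12).
- case: (hr) => _ hs _.
  have le p q : minf xpredT k0 (fun a => rho p (i a) + rho (i (s a)) q) <=
      minf xpredT k0 (fun a => rho q (i a) + rho (i (s a)) p).
    have [a _ ->] := @minf_ex R K xpredT k0 (fun a => rho q (i a) + rho (i (s a)) p) isT.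
    have := @minf_le R K xpredT k0 (fun a => rho p (i a) + rho (i (s a)) q) isT (s a) isT.
    by rewrite sK addrC hs (hs p).
  by move=> [p|p] [q|q]; rewrite /am /amalgam //=; congr vtrunc; apply/eqP; rewrite eq_le !le.
- exact: (@amalgam_eq0 R D r0 hD Dr0 _ _ _ _ _ hr hr _ _ k0 h12).
Qed.

Lemma swapK : involutive swap. Proof. by case. Qed.

End SwapAmalgam.

Section Restriction.
Context (U : choiceType) (F : seq U).

Definition restr (f : U -> U) (p : seq_sub F) : seq_sub F :=
  odflt p (insub (f (val p))).

Lemma restrE f p : f (val p) \in F -> val (restr f p) = f (val p).
Proof. by move=> h; rewrite /restr insubT. Qed.

End Restriction.

Section GenericInvolutions.
Context (R : realType) (D : set R) (r0 : R) (U : metricType R) (x0 : U).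
Hypotheses (hD : distance_value_set D) (Dr0 : D r0) (hU : urysohn_space D U).

Definition inv_at (f : U -> U) : Prop :=
  [/\ involutive f, f x0 = x0 & forall x, f x = x -> x = x0].

(* A finite pseudometric J with involutions t i, and a partial embedding e0,
   defined on J0, of J into U that intertwines t i with T i. Points of J at
   distance 0 need not be equal, hence the closure of J0 under t i only up to
   distance 0. *)
Definition task (I : Type) (T : I -> U -> U) (J : finType) (rho : J -> J -> R)
    (t : I -> J -> J) (J0 : J -> Prop) (e0 : J -> U) (j0 : J) : Prop :=
  [/\ pmet rho, valued D rho, forall i, involutive (t i) &
      forall i u v, rho (t i u) (t i v) = rho u v] /\
  [/\ J0 j0, e0 j0 = x0, forall u v, J0 u -> J0 v -> mdist (e0 u) (e0 v) = rho u v,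
      forall i u, J0 u -> exists v, [/\ J0 v, e0 v = T i (e0 u) & rho (t i u) v = 0] &
      forall i u, rho u (t i u) = 0 -> rho u j0 = 0].

Definition solution (I : Type) (T : I -> U -> U) (J : finType) (rho : J -> J -> R)
    (t : I -> J -> J) (J0 : J -> Prop) (e0 e : J -> U) : Prop :=
  [/\ forall u v, mdist (e u) (e v) = rho u v, forall u, J0 u -> e u = e0 u &
      forall i u, e (t i u) = T i (e u)].

(** A richness property in the sense of Fraisse: every finite extension of a partial copy is
    realized. For pairs, this and local finiteness drive the back-and-forth. *)
Definition generic_family (I : Type) (T : I -> U -> U) : Prop :=
  forall (J : finType) rho (t : I -> J -> J) J0 e0 j0,
  task T rho t J0 e0 j0 -> exists e, solution T rho t J0 e0 e.

Lemma eq_task (I : Type) (T T' : I -> U -> U) (J : finType) rho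
    (t : I -> J -> J) J0 e0 j0 :
  (forall i u, J0 u -> T i (e0 u) = T' i (e0 u)) ->
  task T rho t J0 e0 j0 -> task T' rho t J0 e0 j0.
Proof.
move=> TT' [h1 [h2 h3 h4 h5 h6]]; split => //; split => // i u Ju.
by have [v [Jv ev rv]] := h5 i u Ju; exists v; rewrite -TT'.
Qed.

Lemma eq_solution (I : Type) (T T' : I -> U -> U) (J : finType) rho
    (t : I -> J -> J) J0 e0 e :
  (forall i u, T i (e u) = T' i (e u)) ->
  solution T rho t J0 e0 e -> solution T' rho t J0 e0 e.
Proof. by move=> TT' [h1 h2 h3]; split => // i u; rewrite -TT'. Qed.

(* Countably many tasks suffice: replace J by an ordinal, and rho by the metric
   of a realization of J in U. *)
Section Coding.
Context (I : finType) (en : nat -> U).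
Hypothesis enP : forall x, exists n, en n = x.

Definition task_code : countType := {n : nat &
  ({ffun I * 'I_n -> 'I_n} * {ffun 'I_n -> nat} * {ffun 'I_n -> nat} *
   {ffun 'I_n -> bool} * 'I_n)%type}.

Definition code_rho (k : task_code) (u v : 'I_(tag k)) : R :=
  mdist (en ((tagged k).1.1.1.2 u)) (en ((tagged k).1.1.1.2 v)).
Definition code_t (k : task_code) (i : I) (u : 'I_(tag k)) : 'I_(tag k) :=
  (tagged k).1.1.1.1 (i, u).
Definition code_e0 (k : task_code) (u : 'I_(tag k)) : U := en ((tagged k).1.1.2 u).
Definition code_J0 (k : task_code) (u : 'I_(tag k)) : Prop := (tagged k).1.2 u.
Definition code_j0 (k : task_code) : 'I_(tag k) := (tagged k).2.

Definition ctask (T : I -> U -> U) (k : task_code) : Prop :=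
  task T (@code_rho k) (@code_t k) (@code_J0 k) (@code_e0 k) (code_j0 k).
Definition csolution (T : I -> U -> U) (k : task_code) (e : 'I_(tag k) -> U) : Prop :=
  solution T (@code_rho k) (@code_t k) (@code_J0 k) (@code_e0 k) e.

Lemma generic_coded (T : I -> U -> U) :
  (forall k : task_code, ctask T k -> exists e, csolution T (k := k) e) -> generic_family T.
Proof.
move=> coded J rho t J0 e0 j0 [[h1 h2 h3 h4] [h5 h6 h7 h8 h9]].
have /choice[cod codK] := enP.
have [|v [hv _]] := @urysohn_extension R D U hU J rho (fun=> False) (fun=> x0) h1 h2.
  by [].
pose k : task_code := Tagged (fun n => ({ffun I * 'I_n -> 'I_n} * {ffun 'I_n -> nat} *
    {ffun 'I_n -> nat} * {ffun 'I_n -> bool} * 'I_n)%type)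
  ([ffun x : I * 'I_#|J| => enum_rank (t x.1 (enum_val x.2))],
   [ffun u : 'I_#|J| => cod (v (enum_val u))], [ffun u : 'I_#|J| => cod (e0 (enum_val u))],
   [ffun u : 'I_#|J| => `[< J0 (enum_val u) >]], enum_rank j0).
have kr (u w : 'I_#|J|) : @code_rho k u w = rho (enum_val u) (enum_val w).
  by rewrite /code_rho /= !ffunE !codK hv.
have kt i (u : 'I_#|J|) : @code_t k i u = enum_rank (t i (enum_val u)).
  by rewrite /code_t /= ffunE.
have ke (u : 'I_#|J|) : @code_e0 k u = e0 (enum_val u) by rewrite /code_e0 /= ffunE codK.
have kJ (u : 'I_#|J|) : @code_J0 k u = J0 (enum_val u).
  by rewrite /code_J0 /= ffunE; apply/propext; split => /asboolP.
have [|e [e1 e2 e3]] := coded k.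
  case: (h1) => m1 m2 m3; split; split.
  - by split => *; rewrite !kr.
  - by move=> u w; rewrite kr.
  - by move=> i u; rewrite !kt enum_rankK h3 enum_valK.
  - by move=> i u w; rewrite !kr !kt !enum_rankK h4.
  - by rewrite kJ /code_j0 /= enum_rankK.
  - by rewrite ke /code_j0 /= enum_rankK.
  - by move=> u w; rewrite !kJ => Ju Jw; rewrite !ke kr h7.
  - move=> i u; rewrite kJ => Ju; have [w [Jw ew rw]] := h8 i _ Ju.
    by exists (enum_rank w); rewrite kJ !ke kr kt !enum_rankK.
  - by move=> i u; rewrite !kr kt /code_j0 /= !enum_rankK; exact: h9.
exists (fun j => e (enum_rank j)); split.
- by move=> u w; rewrite e1 kr !enum_rankK.
- by move=> u Ju; rewrite e2 ?ke ?enum_rankK // kJ enum_rankK.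
- by move=> i u; rewrite -e3 kt enum_rankK.
Qed.

End Coding.

Lemma generic_conj (T : unit -> U -> U) (h : Iso U) : h x0 = x0 -> generic_family T ->
  generic_family (fun i x => h (T i (Iso_inv h x))).
Proof.
move=> hx gT J rho t J0 e0 j0 [h1 [h2 h3 h4 h5 h6]].
have [|e [e1 e2 e3]] := gT J rho t J0 (fun u => Iso_inv h (e0 u)) j0.
  split => //; split => //.
  - by rewrite h3 -{1}hx; exact: Iso_funK.
  - by move=> u v Ju Jv; rewrite Iso_isometry h4.
  - move=> i u Ju; have [v [Jv ev rv]] := h5 i u Ju; exists v; split => //.
    by rewrite ev; exact: Iso_funK.
exists (fun u => h (e u)); split.
- by move=> u v; rewrite Iso_isometry.
- by move=> u Ju; rewrite e2 //; exact: Iso_inv_funK.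
- by move=> i u; rewrite e3 /= Iso_funK.
Qed.

Let involution_cond (E : seq U) (g : Iso U) : Prop :=
  [/\ x0 \in E, {in E, forall x, g x \in E}, {in E, forall x, g (g x) = x},
      g x0 = x0 & {in E, forall x, g x = x -> x = x0}].

Let involution_dom x E (g : Iso U) : involution_cond E g ->
  exists E' (g' : Iso U), [/\ involution_cond E' g', refines E g E' g' & x \in E'].
Proof.
move=> [xE cl inv gx fx]; pose J : finType := seq_sub (x :: E).
have EJ y : y \in E -> y \in x :: E by rewrite inE orbC => ->.
pose i (a : seq_sub E) : J := SeqSub (EJ _ (ssvalP a)).
pose s (a : seq_sub E) : seq_sub E := SeqSub (cl _ (ssvalP a)).
have sK : involutive s by move=> a; apply: val_inj; exact: (inv _ (ssvalP a)).
pose k0 : seq_sub E := SeqSub xE.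
have si a b : mdist (val (i (s a))) (val (i (s b))) = mdist (val (i a)) (val (i b)).
  exact: Iso_isometry.
have [am [[am1 am2 am3 am4 am5] am6]] :=
  @swap_amalgamation R D r0 hD Dr0 J (seq_sub E) _ i s k0 (@seq_pmet R U (x :: E))
    (seq_valued hU (F := (x :: E))) sK si.
have [|v [hv ve]] := @urysohn_extension R D U hU (J + J)%type am
    (fun u => if u is inl _ then True else False)
    (fun u => if u is inl p then val p else x0) am1 am2.
  by move=> [p|p] [q|q] // _ _; rewrite am3.
have vl (p : J) : v (inl p) = val p by rewrite ve.
have [|g' hg'] := @partial_isometry_extends R D U hU (J + J)%type v (fun u => v (swap u)).
  by move=> u w; rewrite !hv am5.
have v0 u w : v u = v w <-> am u w = 0.
  by rewrite -hv; split => [->|/(@mdist_positivity R)//]; rewrite mdistxx.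
have inE' u : v u \in map v (enum {: (J + J)%type}) by rewrite map_f // mem_enum.
have gE y (yE : y \in E) : g' y = g y.
  pose a : seq_sub E := SeqSub yE.
  have := hg' (inl (i a)); rewrite vl /= => ->.
  have := am4 (s a); rewrite sK => /v0 <-; exact: vl.
exists (map v (enum {: (J + J)%type})), g'; split; last 2 first.
- by split => y yE; [rewrite -[y]/(val (i (SeqSub yE))) -vl|rewrite gE].
- by rewrite -[x]/(val (SeqSub (mem_head x E) : J)) -vl.
split.
- by rewrite -[x0]/(val (i k0)) -vl.
- by move=> _ /mapP[u _ ->]; rewrite hg'.
- by move=> _ /mapP[u _ ->]; rewrite !hg' swapK.
- by rewrite gE.
- have key (p : J) : am (inl p) (inr p) = 0 -> val p = x0.
    move=> /am6[a [/(@mdist_positivity R) pa /(@mdist_positivity R) ap]].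
    by rewrite pa; apply: fx; [exact: ssvalP|rewrite -[RHS]pa -ap].
  move=> _ /mapP[[p|p] _ ->]; rewrite hg' /= => /v0.
    by case: am1 => _ -> _ /key; rewrite vl.
  move=> h; have /v0 <- := h; rewrite vl; exact: key.
Qed.

(** The task is amalgamated with [E] over [J0]; the two involutions agree there and induce one on
    the amalgam. *)
Let involution_task E (g : Iso U) (J : finType) rho (t : unit -> J -> J) J0 e0 j0 :
  involution_cond E g -> (forall u, J0 u -> e0 u \in E) -> task (fun _ => g) rho t J0 e0 j0 ->
  exists E' (g' : Iso U) e, [/\ involution_cond E' g', refines E g E' g',
    solution (fun _ => g') rho t J0 e0 e & forall u, e u \in E'].
Proof.
move=> [xE cl inv gx fx] eE [[h1 h2 h3 h4] [h5 h6 h7 h8 h9]].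
pose J1 : finType := seq_sub E; pose K : finType := {u : J | `[< J0 u >]}.
have KJ (a : K) : J0 (val a) by exact/asboolP/(valP a).
pose i1 (a : K) : J1 := SeqSub (eE _ (KJ a)); pose i2 (a : K) : J := val a.
pose k0 : K := exist _ j0 (introT (asboolP _) h5).
have h12 a b : mdist (val (i1 a)) (val (i1 b)) = rho (i2 a) (i2 b) by rewrite h7.
have [am [[am1 am2 am3 am4 am5] [am6 am7]]] :=
  @amalgamation R D r0 hD Dr0 J1 J K _ rho (@seq_pmet R U E) h1 (seq_valued hU (F := E)) h2 i1 i2 k0 h12.
pose t1 (p : J1) : J1 := SeqSub (cl _ (ssvalP p)).
have t1K : involutive t1 by move=> p; apply: val_inj; exact: (inv _ (ssvalP p)).
have tm : forall u w, am (sum_map t1 (t tt) u) (sum_map t1 (t tt) w) = am u w.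
  apply: am7 => //.
  - by move=> p q; exact: Iso_isometry.
  - move=> a; have [w [Jw ew rw]] := h8 tt _ (KJ a).
    exists (exist _ w (introT (asboolP _) Jw)); split => //.
    by rewrite /= ew mdistxx.
have [|v [hv ve]] := @urysohn_extension R D U hU (J1 + J)%type am
    (fun u => if u is inl _ then True else False)
    (fun u => if u is inl p then val p else x0) am1 am2.
  by move=> [p|p] [q|q] // _ _; rewrite am3.
have vl (p : J1) : v (inl p) = val p by rewrite ve.
have [|g' hg'] := @partial_isometry_extends R D U hU (J1 + J)%type v
    (fun u => v (sum_map t1 (t tt) u)).
  by move=> u w; rewrite !hv tm.
have v0 u w : v u = v w <-> am u w = 0.
  by rewrite -hv; split => [->|/(@mdist_positivity R)//]; rewrite mdistxx.
have inE' u : v u \in map v (enum {: (J1 + J)%type}) by rewrite map_f // mem_enum.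
have gE y (yE : y \in E) : g' y = g y.
  by have := hg' (inl (SeqSub yE)); rewrite !vl.
have ve0 u : J0 u -> v (inr u) = e0 u.
  move=> Ju; pose a : K := exist _ u (introT (asboolP _) Ju).
  by have /v0 <- := am5 a; rewrite vl.
exists (map v (enum {: (J1 + J)%type})), g', (fun u => v (inr u)); split => //.
- split.
  + by rewrite -[x0]/(val (SeqSub xE : J1)) -vl.
  + by move=> _ /mapP[u _ ->]; rewrite hg'.
  + by move=> _ /mapP[u _ ->]; rewrite !hg' sum_map_involutive.
  + by rewrite gE.
  + move=> _ /mapP[[p|p] _ ->]; rewrite hg' /=.
      by rewrite !vl /=; apply: fx; exact: ssvalP.
    move=> /v0; case: am1 => _ -> _; rewrite am4 => /h9 pj.
    by rewrite -h6 -(ve0 _ h5); apply/v0; rewrite am4.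
- by split => y yE; [rewrite -[y]/(val (SeqSub yE : J1)) -vl|rewrite gE].
- split => [u w|//|[] u]; first by rewrite hv am4.
  by rewrite hg'.
Qed.

Lemma generic_involution : exists tau : Iso U, inv_at tau /\ generic_family (fun _ : unit => tau : U -> U).
Proof.
have cU : countable [set: U] by case: hU.
have [en enP] := countable_enum x0 cU.
(* Whether a code is a task depends on the involution only at points [e0 u]. With these in [E], the
   answer is the same for the condition and for the limit. *)
pose A (k : task_code unit) (E : seq U) (g : Iso U) :=
  (forall u, @code_J0 unit k u -> @code_e0 unit en k u \in E) /\
  (ctask en (fun _ => g) k -> exists e : 'I_(tag k) -> U,
     csolution en (fun _ => g) e /\ forall u, e u \in E).
have doms (l : seq U) E (g : Iso U) : involution_cond E g -> exists E' (g' : Iso U),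
    [/\ involution_cond E' g', refines E g E' g' & {subset l <= E'}].
  elim: l E g => [|y l IH] E g Pg; first by exists E, g; split => //; split.
  have [E1 [g1 [P1 r1 s1]]] := IH E g Pg; have [E2 [g2 [P2 r2 y2]]] := involution_dom y P1.
  exists E2, g2; split => //; first exact: refines_trans r1 r2.
  by move=> z; rewrite inE => /orP[/eqP ->//|/s1]; case: r2 => s2 _ /s2.
have [||||tau [_ tF tA]] := @generic_isometry R U (task_code unit) x0 cU involution_cond A _ _ _ [:: x0] 1%g.
- by move=> x E g; exact: involution_dom.
- move=> y E g Pg; have [E' [g' [P' r' yE]]] := involution_dom y Pg; exists E', g'; split => //.
  case: P' => _ cl inv _ _; apply/mapP; exists (g' y); first exact: cl.
  by rewrite inv.
- move=> k E g Pg.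
  have [E1 [g1 [P1 r1 s1]]] := doms (map (@code_e0 unit en k) (enum 'I_(tag k))) E g Pg.
  have eE u : @code_e0 unit en k u \in E1 by apply: s1; rewrite map_f // mem_enum.
  have [tk|ntk] := pselect (ctask en (fun _ => g1) k); last by exists E1, g1; split.
  have [E2 [g2 [e [P2 r2 s2 e2]]]] := involution_task P1 (fun u _ => eE u) tk.
  exists E2, g2; split => //; first exact: refines_trans r1 r2.
  split => [u _|_]; first by case: r2 => + _; apply.
  by exists e.
- by split => [|x|x||x]; rewrite ?inE // => /eqP ->.
have at1 x : exists E (g : Iso U),
    [/\ involution_cond E g, x \in E, tau x \in E, tau x = g x & tau (tau x) = g (tau x)].
  have [E [g [Pg sE tE]]] := tF [:: x; tau x].
  have xE : x \in E by apply: sE; rewrite mem_head.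
  have txE : tau x \in E by apply: sE; rewrite !inE eqxx orbT.
  by exists E, g; split => //; exact: tE.
exists tau; split.
  split => [x||x tx].
  - have [E [g [[_ _ inv _ _] xE _ e1 e2]]] := at1 x.
    by rewrite e2 e1 inv.
  - by have [E [g [[_ _ _ gx _] _ _ e1 _]]] := at1 x0; rewrite e1.
  - have [E [g [[_ _ _ _ fx] xE _ e1 _]]] := at1 x.
    by apply: fx => //; rewrite -e1.
apply: (generic_coded enP) => k tk; have [E [g [Pg [eE sol] tE]]] := tA k.
have [|e [se eE']] := sol.
  by apply: eq_task tk => _ u Ju; rewrite tE // eE.
by exists e; apply: eq_solution se => _ u; rewrite tE.
Qed.

End GenericInvolutions.

(** * Generic pairs of involutions *)

Section GenericPairs.
Context (R : realType) (D : set R) (r0 : R) (U : metricType R) (x0 : U).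
Hypotheses (hD : distance_value_set D) (Dr0 : D r0) (hU : urysohn_space D U).

Definition conj_map (g om : Iso U) (x : U) : U := g (om (Iso_inv g x)).

Definition pair_map (tau om g : Iso U) (b : bool) : U -> U :=
  if b then tau : U -> U else conj_map g om.

(** Two involutions generate a dihedral group, possibly infinite, while back-and-forth needs finite
    sets closed under both. *)
Definition locally_finite (T : bool -> U -> U) : Prop :=
  forall w, exists2 W : seq U, w \in W & forall b, {in W, forall y, T b y \in W}.

Lemma conj_map_on (g om : Iso U) x : conj_map g om (g x) = g (om x).
Proof. by rewrite /conj_map /= Iso_funK. Qed.

Lemma conj_map_isometry (g om : Iso U) x y : mdist (conj_map g om x) (conj_map g om y) = mdist x y.
Proof. by rewrite /conj_map !Iso_isometry. Qed.

Lemma conj_map_inv_at (g om : Iso U) : g x0 = x0 -> inv_at x0 om -> inv_at x0 (conj_map g om).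
Proof.
move=> gx [ok ox of0]; have gx' : Iso_inv_fun g x0 = x0 by rewrite -{1}gx Iso_funK.
split => [x||x]; rewrite /conj_map /=; first by rewrite Iso_funK ok Iso_inv_funK.
  by rewrite gx' ox gx.
move=> /(congr1 (Iso_inv_fun g)); rewrite Iso_funK => /of0 h.
by rewrite -(Iso_inv_funK g x) h gx.
Qed.

Section Step.
Context (tau om : Iso U).
Hypotheses (itau : inv_at x0 tau) (iom : inv_at x0 om).
Hypotheses (gtau : generic_family D x0 (fun _ : unit => tau : U -> U))
  (gom : generic_family D x0 (fun _ : unit => om : U -> U)).

(** The unknown is the conjugator [g]. Closure of [E] under [om] makes [g] on [E] decide the
    conjugate of [om] on [map g E]. *)
Definition closed_cond (E : seq U) (g : Iso U) : Prop :=
  [/\ x0 \in E, g x0 = x0 & {in E, forall x, om x \in E}].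

(** [J] is realized twice: by [e], where [t] becomes [tau], and by [f], where [s] becomes [om]. An
    isometry [g'] taking [f] to [e] then turns [s] on the first copy into the conjugate of [om] by
    [g']. *)
Lemma pair_step E (g : Iso U) (J : finType) (rho : J -> J -> R) (t s : J -> J)
    (J0 J1 : J -> Prop) (e0 : J -> U) (j0 : J) :
  closed_cond E g ->
  pmet rho -> valued D rho -> involutive t -> involutive s ->
  (forall u v, rho (t u) (t v) = rho u v) -> (forall u v, rho (s u) (s v) = rho u v) ->
  (forall u, rho u (t u) = 0 \/ rho u (s u) = 0 -> rho u j0 = 0) ->
  (forall u, J1 u -> J0 u) -> J1 j0 -> e0 j0 = x0 ->
  (forall u v, J0 u -> J0 v -> mdist (e0 u) (e0 v) = rho u v) ->
  (forall u, J0 u -> exists v, [/\ J0 v, e0 v = tau (e0 u) & rho (t u) v = 0]) ->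
  (forall u, J1 u -> e0 u \in map g E) ->
  (forall x, x \in E -> exists2 u, J1 u & e0 u = g x) ->
  (forall u, J1 u -> exists v, [/\ J1 v, e0 v = conj_map g om (e0 u) & rho (s u) v = 0]) ->
  exists E' (g' : Iso U) (e : J -> U),
    [/\ closed_cond E' g', refines E g E' g', forall u, e u \in map g' E',
        forall y, y \in map g' E' -> exists u, y = e u &
        [/\ forall u v, mdist (e u) (e v) = rho u v, forall u, J0 u -> e u = e0 u,
            forall u, e (t u) = tau (e u) & forall u, e (s u) = conj_map g' om (e u)]].
Proof.
move=> [xE gx cl] h1 h2 tK sK ti si fx J10 Jj ej ie ct eE Ee cs.
have gx' : Iso_inv_fun g x0 = x0 by rewrite -{1}gx Iso_funK.
have [|e [e1 e2 e3]] := gtau (J := J) (rho := rho) (t := fun _ => t) (J0 := J0)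
    (e0 := e0) (j0 := j0).
  split; split => //.
  - exact: J10.
  - by move=> _ u h; apply: fx; left.
have [|f [f1 f2 f3]] := gom (J := J) (rho := rho) (t := fun _ => s) (J0 := J1)
    (e0 := fun u => Iso_inv g (e0 u)) (j0 := j0).
  split; split => //.
  - by rewrite ej.
  - by move=> u v Ju Jv; rewrite Iso_isometry ie //; exact: J10.
  - move=> _ u Ju; have [v [Jv ev rv]] := cs u Ju; exists v; split => //.
    by rewrite ev /conj_map /= Iso_funK.
  - by move=> _ u h; apply: fx; right.
have [|g' hg'] := @partial_isometry_extends R D U hU J f e.
  by move=> u v; rewrite f1 e1.
have fin u : f u \in map f (enum J) by rewrite map_f // mem_enum.
have ein u : e u \in map g' (map f (enum J)).
  by rewrite -hg' map_f.
have fx0 : f j0 = x0 by rewrite f2 //= ej.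
exists (map f (enum J)), g', e; split => //.
- split; first by rewrite -fx0.
    by rewrite -{1}fx0 hg' e2 ?ej //; exact: J10.
  by move=> _ /mapP[u _ ->]; rewrite -(f3 tt).
- have key x : x \in E -> exists2 u, f u = x & e u = g x.
    move=> /Ee[u Ju eu]; exists u; last by rewrite e2 //; exact: J10.
    by rewrite f2 //= eu Iso_funK.
  split => x /key[u <- eu]; first by [].
  by rewrite hg'.
- by move=> y /mapP[_ /mapP[u _ ->] ->]; exists u; rewrite hg'.
- split => // u; first exact: (e3 tt).
  by rewrite -hg' (f3 tt) -conj_map_on hg'.
Qed.

(** On the finite set [F], [tau] is total but the conjugate of [om] is known only on [map g E];
    extending both to a finite space gives the input of [pair_step]. *)
Lemma closed_dense E (g : Iso U) w : closed_cond E g ->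
  exists E' (g' : Iso U), [/\ closed_cond E' g', refines E g E' g',
    w \in map g' E' & {in map g' E', forall y, tau y \in map g' E'}].
Proof.
move=> Pg; have [xE gx cl] := Pg; have [tK tx tf] := itau.
have gxE : x0 \in map g E by rewrite -gx map_f.
pose F0 := w :: map g E; pose F := F0 ++ map tau F0.
have F0F y : y \in F0 -> y \in F by move=> h; rewrite mem_cat h.
have tF y : y \in F -> tau y \in F.
  rewrite !mem_cat => /orP[h|/mapP[z h ->]]; first by rewrite map_f // orbT.
  by rewrite tK h.
have gF y : y \in map g E -> y \in F by move=> h; apply: F0F; rewrite inE h orbT.
have cg y : y \in map g E -> conj_map g om y \in map g E.
  by move=> /mapP[z zE ->]; rewrite conj_map_on map_f // cl.
have [cK cx cf] := conj_map_inv_at gx iom.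
pose P : finType := seq_sub F.
pose t (p : P) : P := restr tau p; pose s (p : P) : P := restr (conj_map g om) p.
pose Dm (p : P) := val p \in map g E.
have tE (p : P) : val (t p) = tau (val p) by apply: restrE; apply: tF; exact: ssvalP.
have sE (p : P) : Dm p -> val (s p) = conj_map g om (val p).
  by move=> Dp; apply: restrE; apply: (gF); exact: cg.
pose o : P := SeqSub (gF _ gxE).
have Ds p : Dm p -> Dm (s p) by move=> Dp; rewrite /Dm sE //; exact: cg.
have so : s o = o by apply: val_inj; rewrite sE ?/Dm //= cx.
have [|||||||||||J [rho [T [S [i [[j1 j2 j3 j4] [[j5 j6 j7 j8 [j9 j10]] j11]]]]]]] :=
  @involutions_extend R D r0 hD Dr0 P (fun i j => mdist (val i) (val j))
    (@seq_pmet R U F) (seq_valued hU (F := F)) _ t s Dm o.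
- by move=> p q /(@mdist_positivity R)/val_inj.
- by move=> p; apply: val_inj; rewrite !tE tK.
- by move=> p q; rewrite !tE Iso_isometry.
- exact: Ds.
- by move=> p Dp; apply: val_inj; rewrite !sE ?cK //; exact: Ds.
- by move=> p q Dp Dq; rewrite !sE // conj_map_isometry.
- exact: gxE.
- by apply: val_inj; rewrite tE /= tx.
- exact: so.
- by move=> p /(congr1 val); rewrite tE => /tf h; apply: val_inj.
- by move=> p Dp /(congr1 val); rewrite sE // => /cf h; apply: val_inj.
have [p q /j7 -> //|e0 he0] := lift_fun x0 (v := i) (w := fun p : P => val p).
have [||||||||E' [g' [e [P' r' e1 e2 [e3 e4 e5 e6]]]]] := @pair_step E g J rho T S
  (fun j => exists p, j = i p) (fun j => exists2 p, Dm p & j = i p) e0 (i o)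
  Pg j1 j2 j3 j4 j5 j6 j11.
- by move=> _ [p _ ->]; exists p.
- by exists o.
- by rewrite he0.
- by move=> _ _ [p ->] [q ->]; rewrite !he0 j8.
- move=> _ [p ->]; exists (i (t p)); split; first by exists (t p).
    by rewrite !he0 tE.
  by rewrite j9; case: j1.
- by move=> _ [p Dp ->]; rewrite he0.
- move=> x xE'; have gxF : g x \in F by apply: (gF); rewrite map_f.
  by exists (i (SeqSub gxF)); [exists (SeqSub gxF) => //; rewrite /Dm /= map_f|rewrite he0].
- move=> _ [p Dp ->]; exists (i (s p)); split; first by exists (s p) => //; exact: Ds.
    by rewrite !he0 sE.
  exact: j10.
exists E', g'; split => //.
  have wF : w \in F by apply: F0F; exact: mem_head.
  by have := e1 (i (SeqSub wF)); rewrite e4 ?he0 //; exists (SeqSub wF).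
by move=> y /e2[u ->]; rewrite -e5.
Qed.

(** Since [map g E] is closed under both involutions, it can be amalgamated with the task, and
    [pair_step] realizes the amalgam. *)
Lemma pair_task_dense E (g : Iso U) (J : finType) rho (t : bool -> J -> J) J0 e0 j0 :
  closed_cond E g -> {in map g E, forall y, tau y \in map g E} ->
  (forall u, J0 u -> e0 u \in map g E) ->
  task D x0 (pair_map tau om g) rho t J0 e0 j0 ->
  exists E' (g' : Iso U) e, [/\ closed_cond E' g', refines E g E' g',
    solution (pair_map tau om g') rho t J0 e0 e & forall u, e u \in map g' E'].
Proof.
move=> Pg tc eE [[h1 h2 h3 h4] [h5 h6 h7 h8 h9]]; have [xE gx cl] := Pg.
have [tK tx tf] := itau; have [cK cx cf] := conj_map_inv_at gx iom.
have cg y : y \in map g E -> conj_map g om y \in map g E.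
  by move=> /mapP[z zE ->]; rewrite conj_map_on map_f // cl.
pose J1 : finType := seq_sub (map g E); pose K : finType := {u : J | `[< J0 u >]}.
have KJ (a : K) : J0 (val a) by exact/asboolP/(valP a).
pose i1 (a : K) : J1 := SeqSub (eE _ (KJ a)); pose i2 (a : K) : J := val a.
pose k0 : K := exist _ j0 (introT (asboolP _) h5).
have h12 a b : mdist (val (i1 a)) (val (i1 b)) = rho (i2 a) (i2 b) by rewrite h7.
have [am [[am1 am2 am3 am4 am5] [am6 am7]]] :=
  @amalgamation R D r0 hD Dr0 J1 J K _ rho (@seq_pmet R U (map g E)) h1 (seq_valued hU (F := (map g E)))
    h2 i1 i2 k0 h12.
pose t1 (p : J1) : J1 := SeqSub (tc _ (ssvalP p)).
pose s1 (p : J1) : J1 := SeqSub (cg _ (ssvalP p)).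
have t1K : involutive t1 by move=> p; apply: val_inj; exact: tK.
have s1K : involutive s1 by move=> p; apply: val_inj; exact: cK.
have iso b (f : J1 -> J1) : involutive f -> (forall p, val (f p) = pair_map tau om g b (val p)) ->
    (forall p q, mdist (val (f p)) (val (f q)) = mdist (val p) (val q)) ->
    forall u w, am (sum_map f (t b) u) (sum_map f (t b) w) = am u w.
  move=> fK fE fi; apply: am7 => //.
  move=> a; have [w [Jw ew rw]] := h8 b _ (KJ a).
  exists (exist _ w (introT (asboolP _) Jw)); split => //.
  by rewrite fE /= ew mdistxx.
have xg : x0 \in map g E by rewrite -gx map_f.
pose o : J1 := SeqSub xg.
have oj : am (inl o) (inr j0) = 0.
  have := am5 k0; congr (am (inl _) _ = _); apply: val_inj; exact: h6.
have [p2 p3] : (forall x y, am x y = am y x) /\ (forall x y z, am x z <= am x y + am y z).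
  by case: am1.
have amc x : am x (inr j0) = 0 -> am x (inl o) = 0.
  move=> xj; apply/eqP; rewrite eq_le (pmet_ge0 _ _ am1) andbT.
  by have := p3 x (inr j0) (inl o); rewrite xj (p2 (inr j0)) oj addr0.
have fixed b (f : J1 -> J1) : (forall p, val (f p) = pair_map tau om g b (val p)) ->
    (forall x, pair_map tau om g b x = x -> x = x0) ->
    forall u, am u (sum_map f (t b) u) = 0 -> am u (inl o) = 0.
  move=> fE ff [p|u] /=; last by rewrite am4 => /h9 h; apply: amc; rewrite am4.
  rewrite !am3 fE => /(@mdist_positivity R) /esym /ff ->; exact: mdistxx.
have [|||||||||||||E' [g' [e [P' r' e1 e2 [e3 e4 e5 e6]]]]] := @pair_step E g (J1 + J)%type am
  (sum_map t1 (t true)) (sum_map s1 (t false))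
  (fun u => if u is inl _ then True else False) (fun u => if u is inl _ then True else False)
  (fun u => if u is inl p then val p else x0) (inl o) Pg am1 am2.
- exact: sum_map_involutive.
- exact: sum_map_involutive.
- by apply: (iso true) => // p q; exact: Iso_isometry.
- by apply: (iso false) => // p q; exact: conj_map_isometry.
- by move=> u [|]; [apply: (fixed true)|apply: (fixed false)].
- by [].
- by [].
- by [].
- by move=> [p|p] [q|q] // _ _; rewrite am3.
- by move=> [p|//] _; exists (inl (t1 p)); split => //; case: am1.
- by move=> [p|//] _; exact: ssvalP.
- by move=> x xE'; exists (inl (SeqSub (map_f g xE'))).
- by move=> [p|//] _; exists (inl (s1 p)); split => //; case: am1.
exists E', g', (fun u => e (inr u)); split => //; split.
- by move=> u v; rewrite e3 am4.
- move=> u Ju; pose a : K := exist _ u (introT (asboolP _) Ju).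
  transitivity (e (inl (i1 a))); last by rewrite e4.
  by apply: (@mdist_positivity R); rewrite e3 p2; exact: (am5 a).
- by move=> [] u; [exact: (e5 (inr u))|exact: (e6 (inr u))].
Qed.

End Step.
End GenericPairs.

(** * Point stabilizers as products of three centralizers *)

Section StabilizerDecomposition.
Context (R : realType) (D : set R) (r0 : R) (U : metricType R) (x0 : U).
Hypotheses (hD : distance_value_set D) (Dr0 : D r0) (hU : urysohn_space D U).

Let cU : countable [set: U]. Proof. by case: hU. Qed.

(** One conjugator [h] serves two involutions [tau c] at once, which provides the common partner of
    tau and g tau g^-1. *)
Lemma generic_pair (tau : bool -> Iso U) (om : Iso U) :
  (forall c, inv_at x0 (tau c)) -> inv_at x0 om ->
  (forall c, generic_family D x0 (fun _ : unit => tau c : U -> U)) ->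
  generic_family D x0 (fun _ : unit => om : U -> U) ->
  exists2 h : Iso U, h x0 = x0 & forall c,
    locally_finite (pair_map (tau c) om h) /\ generic_family D x0 (pair_map (tau c) om h).
Proof.
move=> itau iom gtau gom; have [en enP] := countable_enum x0 cU.
pose K : countType := ((bool * nat) + (bool * task_code bool))%type.
pose A (k : K) (E : seq U) (g : Iso U) : Prop := match k with
  | inl (c, n) => en n \in map g E /\ {in map g E, forall y, tau c y \in map g E}
  | inr (c, k) => (forall u, @code_J0 bool k u -> code_e0 en u \in map g E) /\
     (ctask D x0 en (pair_map (tau c) om g) k -> exists e : 'I_(tag k) -> U,
        csolution en (pair_map (tau c) om g) e /\ forall u, e u \in map g E)
  end.
have iom' := iom; case: iom' => omK omx omf.
have rans (l : seq U) E (g : Iso U) : closed_cond x0 om E g -> exists E' (g' : Iso U),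
    [/\ closed_cond x0 om E' g', refines E g E' g' & {subset l <= map g' E'}].
  move=> [xE gx cl]; pose l' := map (Iso_inv g) l.
  exists (E ++ l' ++ map om l'), g; split.
  - split => //; first by rewrite mem_cat xE.
    move=> x; rewrite !mem_cat => /or3P[/cl ->//|xl|/mapP[y yl ->]].
      by rewrite (map_f om xl) !orbT.
    by rewrite omK yl orbT.
  - by split => // x xE'; rewrite mem_cat xE'.
  - move=> y yl; apply/mapP; exists (Iso_inv g y); last by rewrite Iso_inv_funK.
    by rewrite !mem_cat (map_f (Iso_inv g) yl) orbT.
have [||||h [h0 hF hA]] := @generic_isometry R U K x0 cU (closed_cond x0 om) A _ _ _ [:: x0] 1%g.
- move=> x E g [xE gx cl]; exists [:: x, om x & E], g; split => //; last exact: mem_head.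
  + split => //; first by rewrite !inE xE !orbT.
    move=> y; rewrite !inE => /or3P[/eqP->|/eqP->|/cl->]; rewrite ?omK ?eqxx ?orbT //.
  + by split => // y yE; rewrite !inE yE !orbT.
- move=> y E g Pg; have [E' [g' [P' r' s']]] := rans [:: y] E g Pg.
  by exists E', g'; split => //; apply: s'; exact: mem_head.
- move=> [[c n]|[c k]] E g Pg.
    have [E' [g' [P' r' w' c']]] :=
      closed_dense hD Dr0 hU (itau c) iom (gtau c) gom (en n) Pg.
    by exists E', g'; split.
  have [E1 [g1 [P1 r1 s1]]] := rans (map (@code_e0 R U bool en k) (enum 'I_(tag k))) E g Pg.
  have [E2 [g2 [P2 r2 _ c2]]] := closed_dense hD Dr0 hU (itau c) iom (gtau c) gom x0 P1.
  have eE u : @code_e0 R U bool en k u \in map g2 E2.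
    have /mapP[x xE ->] : @code_e0 R U bool en k u \in map g1 E1.
      by apply: s1; rewrite map_f // mem_enum.
    by case: r2 => s2 a2; rewrite a2 // map_f // s2.
  have r12 := refines_trans r1 r2.
  have [tk|ntk] := pselect (ctask D x0 en (pair_map (tau c) om g2) k); last first.
    by exists E2, g2; split.
  have [E3 [g3 [e [P3 r3 s3 e3]]]] :=
    pair_task_dense hD Dr0 hU (itau c) iom (gtau c) gom P2 c2 (fun u _ => eE u) tk.
  exists E3, g3; split => //; first exact: refines_trans r12 r3.
  split => [u _|_]; last by exists e.
  have /mapP[x xE ->] := eE u; case: r3 => s3' a3.
  by rewrite a3 // map_f // s3'.
- by split => [||x]; rewrite ?inE // => /eqP ->; rewrite omx.
have hx : h x0 = x0 by rewrite h0 // mem_head.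
have agr E (g : Iso U) : closed_cond x0 om E g -> {in E, h =1 g} ->
    forall c b y, y \in map g E -> pair_map (tau c) om h b y = pair_map (tau c) om g b y.
  move=> [_ _ cl] hE c [] // y /mapP[x xE ->] /=.
  by rewrite conj_map_on -{1}hE // conj_map_on hE // cl.
exists h => // c; split.
  move=> w; have [n <-] := enP w; have [E [g [Pg [wE cE] hE]]] := hA (inl (c, n)).
  exists (map g E) => // b y yE; rewrite (agr E g Pg hE) //.
  case: b => /=; first exact: cE.
  case: (Pg) => _ _ cl; move/mapP: yE => [x xE ->].
  by rewrite conj_map_on map_f // cl.
apply: (generic_coded hU enP) => k tk; have [E [g [Pg [eE sol] hE]]] := hA (inr (c, k)).
have [|e [se eE']] := sol.
  by apply: eq_task tk => b u Ju; rewrite (agr E g Pg hE) // eE.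
by exists e; apply: eq_solution se => b u; rewrite (agr E g Pg hE).
Qed.

Lemma locally_finite_seq (T : bool -> U -> U) (l : seq U) : locally_finite T ->
  exists2 W : seq U, {subset l <= W} & forall b, {in W, forall y, T b y \in W}.
Proof.
move=> lf; elim: l => [|x l [W lW cW]]; first by exists [::].
have [V xV cV] := lf x; exists (V ++ W).
  by move=> y; rewrite inE mem_cat => /orP[/eqP ->|/lW ->]; rewrite ?xV ?orbT.
move=> b y; rewrite !mem_cat => /orP[/cV ->//|/cW ->]; by rewrite orbT.
Qed.

Lemma embed_closed (T : bool -> U -> U) (W A : seq U) (S : bool -> U -> U) (g : Iso U) :
  (forall b, inv_at x0 (S b)) -> (forall b x y, mdist (S b x) (S b y) = mdist x y) ->
  generic_family D x0 T ->
  (forall b, {in W, forall y, S b y \in W}) -> {subset A <= W} -> x0 \in A -> g x0 = x0 ->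
  (forall b, {in A, forall y, S b y \in A}) ->
  (forall b, {in A, forall y, g (S b y) = T b (g y)}) ->
  exists2 g' : Iso U, {in A, g =1 g'} & forall b, {in W, forall y, g' (S b y) = T b (g' y)}.
Proof.
move=> iS mS gT cW AW xA gx cA eq; pose J : finType := seq_sub W.
have mW (p : J) b : S b (val p) \in W by apply: cW; exact: ssvalP.
pose t b (p : J) : J := SeqSub (mW p b).
pose o : J := SeqSub (AW _ xA).
have [|e [e1 e2 e3]] := gT J (fun i j => mdist (val i) (val j)) t (fun j => val j \in A)
    (fun j => g (val j)) o.
  split; split => //.
  - exact: seq_pmet.
  - exact: seq_valued.
  - by move=> b p; apply: val_inj; case: (iS b) => k _ _; exact: k.
  - by move=> b p q; exact: mS.
  - by move=> p q _ _; rewrite Iso_isometry.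
  - move=> b p pA; exists (t b p); split; [exact: cA|exact: eq|exact: mdistxx].
  - move=> b p /(@mdist_positivity R) /esym h; case: (iS b) => _ _ /(_ _ h) ->.
    exact: mdistxx.
have [|g' hg'] := @partial_isometry_extends R D U hU J (fun j => val j) e.
  by move=> p q; rewrite e1.
exists g'.
  by move=> y yA; rewrite (hg' (SeqSub (AW _ yA))) e2.
by move=> b y yW; rewrite (hg' (t b (SeqSub yW))) e3 (hg' (SeqSub yW)).
Qed.

Lemma generic_pairs_conjugate (T T' : bool -> U -> U) :
  (forall b, inv_at x0 (T b)) -> (forall b, inv_at x0 (T' b)) ->
  (forall b x y, mdist (T b x) (T b y) = mdist x y) ->
  (forall b x y, mdist (T' b x) (T' b y) = mdist x y) ->
  locally_finite T -> locally_finite T' -> generic_family D x0 T -> generic_family D x0 T' ->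
  exists c : Iso U, forall b x, c (T b x) = T' b (c x).
Proof.
move=> iT iT' mT mT' lT lT' gT gT'.
pose P (E : seq U) (g : Iso U) := [/\ x0 \in E, g x0 = x0,
  forall b, {in E, forall x, T b x \in E} &
  forall b, {in E, forall x, g (T b x) = T' b (g x)}].
have [||||c [_ cF _]] := @generic_isometry R U void x0 cU P (fun _ _ _ => True) _ _ _ [:: x0] 1%g.
- move=> x E g [xE gx cl eq]; have [W lW cW] := locally_finite_seq (x :: E) lT.
  have EW : {subset E <= W} by move=> y yE; apply: lW; rewrite inE yE orbT.
  have [g' gg' eq'] := embed_closed iT mT gT' cW EW xE gx cl eq.
  exists W, g'; split; [split => //|split => //|].
  + exact: EW.
  + by rewrite -gg'.
  + by apply: lW; exact: mem_head.
- move=> y E g [xE gx cl eq]; have [W lW cW] := locally_finite_seq (y :: map g E) lT'.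
  have EW : {subset map g E <= W} by move=> z zE; apply: lW; rewrite inE zE orbT.
  have xg : x0 \in map g E by rewrite -gx map_f.
  have gx' : Iso_inv g x0 = x0 by rewrite /= -{1}gx Iso_funK.
  have clg b : {in map g E, forall z, T' b z \in map g E}.
    by move=> _ /mapP[x xE' ->]; rewrite -eq // map_f // cl.
  have eqg b : {in map g E, forall z, Iso_inv g (T' b z) = T b (Iso_inv g z)}.
    by move=> _ /mapP[x xE' ->]; rewrite -eq //= !Iso_funK.
  (* The backward step extends the inverse of [g], with the two pairs exchanged. *)
  have [f gf eqf] := embed_closed iT' mT' gT cW EW xg gx' clg eqg.
  have ff x : x \in E -> f (g x) = x by move=> xE'; rewrite -gf ?map_f //= Iso_funK.
  exists (map f W), (Iso_inv f); split.
  + split.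
    * by rewrite -(ff x0 xE) gx map_f // EW.
    * by rewrite /= -{1}(ff x0 xE) gx Iso_funK.
    * by move=> b _ /mapP[w wW ->]; rewrite -eqf // map_f // cW.
    * by move=> b _ /mapP[w wW ->]; rewrite -eqf //= !Iso_funK.
  + split => x xE'; first by rewrite -(ff x xE') map_f // EW // map_f.
    by rewrite /= -{2}(ff x xE') Iso_funK.
  + apply/mapP; exists (f y); last by rewrite /= Iso_funK.
    by rewrite map_f //; apply: lW; exact: mem_head.
- by case.
- split => [||b x|b x]; rewrite ?inE //= => /eqP ->.
    by case: (iT b) => _ -> _.
  by case: (iT b) => _ -> _; case: (iT' b) => _ -> _.
exists c => b x; have [E [g [[_ _ cl eq] sE cE]]] := cF [:: x].
have xE : x \in E by apply: sE; exact: mem_head.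
by rewrite cE ?eq ?cE // cl.
Qed.

Lemma stabilizer_decomposition : exists tau sigma : Iso U, forall g : Iso U,
  g x0 = x0 <-> exists c d e : Iso U,
    [/\ centralizes tau c, centralizes sigma d, centralizes tau e & g = (c * d * e)%g].
Proof.
have [tau [itau gtau]] := generic_involution x0 hD Dr0 hU.
have [h hx hpair] := generic_pair (fun _ : bool => itau) itau (fun _ : bool => gtau) gtau.
pose sg : Iso U := (h * tau * h^-1)%g.
have isg : inv_at x0 sg by exact: conj_map_inv_at.
have gsg : generic_family D x0 (fun _ : unit => sg : U -> U) by exact: (generic_conj hx gtau).
have pm_iso (a b k : Iso U) i x y :
    mdist (pair_map a b k i x) (pair_map a b k i y) = mdist x y.
  by case: i; [exact: Iso_isometry|exact: conj_map_isometry].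
have pm_inv (a b k : Iso U) : inv_at x0 a -> inv_at x0 b -> k x0 = x0 ->
    forall i, inv_at x0 (pair_map a b k i).
  by move=> ia ib kx [] //; exact: conj_map_inv_at.
have cenx (s c : Iso U) : inv_at x0 s -> centralizes s c -> c x0 = x0.
  move=> [_ sx sf] sc; apply: sf; rewrite -sc sx //.
exists tau, sg => g; split => [gx|[c [d [e [cc cd ce ->]]]]]; last first.
  by rewrite /= (cenx tau e) // (cenx sg d) // (cenx tau c).
have itg : inv_at x0 (g * tau * g^-1)%g by exact: conj_map_inv_at.
have gtg : generic_family D x0 (fun _ : unit => (g * tau * g^-1)%g : U -> U) by exact: (generic_conj gx gtau).
pose tt2 (b : bool) : Iso U := if b then tau else (g * tau * g^-1)%g.
have [k kx kpair] : exists2 k : Iso U, k x0 = x0 & forall c,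
    locally_finite (pair_map (tt2 c) sg k) /\ generic_family D x0 (pair_map (tt2 c) sg k).
  by apply: generic_pair => // -[].
have [c hc] : exists c : Iso U, forall b x,
    c (pair_map tau tau h b x) = pair_map tau sg k b (c x).
  have [l1 g1] := hpair true; have [l2 g2] := kpair true.
  by apply: generic_pairs_conjugate => //; apply: pm_inv.
have [c2 hc2] : exists c : Iso U, forall b x,
    c (pair_map tau tau h b x) = pair_map (g * tau * g^-1)%g sg k b (c x).
  have [l1 g1] := hpair true; have [l2 g2] := kpair false.
  by apply: generic_pairs_conjugate => //; apply: pm_inv.
(* With sigma' the conjugate of [sg] by [k], [c] carries (tau, sg) to (tau, sigma') and [c2] carries
   it to (g tau g^-1, sigma'). *)
exists c, (c^-1 * c2)%g, (c2^-1 * g)%g; split.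
- by move=> x; exact: (hc true).
- move=> x /=; have := hc2 false x; rewrite /= -/(sg x) => e2.
  apply: (@Iso_inj _ _ c); rewrite Iso_inv_funK.
  have := hc false (Iso_inv_fun c (c2 x)); rewrite /= Iso_inv_funK => e1.
  by rewrite e2 -e1.
- move=> x /=; apply: (@Iso_inj _ _ c2); rewrite Iso_inv_funK.
  have := hc2 true (Iso_inv_fun c2 (g x)); rewrite /= Iso_inv_funK => ->.
  by rewrite Iso_funK.
- by rewrite !mulgA mulgV mul1g mulgV mul1g.
Qed.

End StabilizerDecomposition.

(** * Automatic openness and the empty value set *)

Section Assembly.
Context (R : realType).

Lemma centralizesE (X : metricType R) (s g : Iso X) : centralizes s g <-> (g * s = s * g)%g.
Proof.
split=> [h|h x]; first exact: Iso_eq.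
by rewrite -[LHS]/((g * s)%g x) h.
Qed.

Lemma stabilizer_image_open (D L : set R) (X Y : metricType R) (r0 : R)
    (phi : Iso X -> Iso Y) (psi : Iso Y -> Iso X) :
  distance_value_set D -> distance_value_set L -> D r0 ->
  urysohn_space D X -> urysohn_space L Y ->
  {morph phi : g h / (g * h)%g} -> cancel phi psi -> cancel psi phi ->
  forall x : X, exists A : seq Y, supports A [set h | psi h x = x].
Proof.
move=> hD hL Dr hX hY phiM phiK psiK x.
have psiM : {morph psi : g h / (g * h)%g}.
  by move=> g h; rewrite -{1}(psiK g) -{1}(psiK h) -phiM phiK.
have psi1 : psi 1%g = 1%g by apply: (mulgI (psi 1%g)); rewrite -psiM !mulg1.
have psiV g : psi (g^-1)%g = ((psi g)^-1)%g.
  by apply: (mulgI (psi g)); rewrite -psiM !mulgV.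
have [tau [sg dec]] := stabilizer_decomposition x hD Dr hX.
have [y0 _] := urysohn_inhabited hL hY.
have cX : countable [set: X] by case: hX.
have cY : countable [set: Y] by case: hY.
have cen_phi s c : centralizes s c -> centralizes (phi s) (phi c).
  by move=> /centralizesE h; apply/centralizesE; rewrite -!phiM h.
have cen_psi s c : centralizes (phi s) c -> centralizes s (psi c).
  by move=> /centralizesE h; apply/centralizesE; rewrite -{1 2}(phiK s) -!psiM h.
apply: (triple_product_open y0 cY (a := phi tau) (b := phi sg)).
- split => [|g h|g]; rewrite /= ?psi1 ?psiM ?psiV //=; first by move=> gx ->.
  by move=> gx; rewrite -{1}gx Iso_funK.
- move=> g; rewrite /= dec; split => [[c [d [e [h1 h2 h3 e1]]]]|[c [d [e [h1 h2 h3 ->]]]]].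
    exists (phi c), (phi d), (phi e); split; try exact: cen_phi.
    by rewrite -!phiM -e1 psiK.
  by exists (psi c), (psi d), (psi e); split; [exact: cen_psi..|rewrite !psiM].
- have [en enP] := countable_enum x cX.
  (* Cosets of the stabilizer correspond to the points of the orbit of x, so there are countably
     many. *)
  have /choice[r hr] : forall n, exists g, (exists h, psi h x = en n) -> psi g x = en n.
    move=> n; have [[h hn]|nh] := pselect (exists h, psi h x = en n).
      by exists h.
    by exists 1%g.
  exists r => g; have [n en_n] := enP (psi g x); exists n.
  rewrite /= psiM psiV /= -en_n -(hr n) ?Iso_funK //.
  by exists g.
Qed.

Lemma isomorphic_equivalent (D L : set R) (X Y : metricType R) :
  distance_value_set D -> distance_value_set L ->
  urysohn_space D X -> urysohn_space L Y ->
  group_isomorphic (Iso X) (Iso Y) -> equivalent_value_sets D L.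
Proof.
move=> hD hL hX hY [phi [psi phiK psiK]].
have phiM : {morph phi : g h / (g * h)%g} by exact: gmulfM.
have psiM : {morph psi : g h / (g * h)%g}.
  by move=> g h; rewrite -{1}(psiK g) -{1}(psiK h) -phiM phiK.
have trivial_iso (E : set R) (Z : metricType R) : urysohn_space E Z ->
    ~ (exists r, E r) -> forall g h : Iso Z, g = h.
  move=> [_ hE _ _] nE g h; apply: Iso_eq => x; apply/eqP; apply: contraT => gh.
  by case: nE; exists (mdist (g x) (h x)); exact: hE.
have nontrivial_iso (E : set R) (Z : metricType R) (r : R) : distance_value_set E -> E r ->
    urysohn_space E Z -> ~ (forall g h : Iso Z, g = h).
  move=> hE Er hZ triv; have [z _] := urysohn_inhabited hE hZ.
  have [g] := movable hE hZ Er z.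
  by rewrite (triv g 1%g) eqxx.
(* An empty value set gives a trivial isometry group and a nonempty one does not, so both sets are
   empty or neither is. *)
have [[r Dr]|nD] := pselect (exists r, D r); have [[s Ls]|nL] := pselect (exists s, L s).
- apply: (equivalence_of_isomorphism hD hL Dr Ls hX hY phiM phiK psiK).
    exact: (stabilizer_image_open hD hL Dr hX hY phiM phiK psiK).
  exact: (stabilizer_image_open hL hD Ls hY hX psiM psiK phiK).
- exfalso; apply: (nontrivial_iso D X r) => // g h.
  by apply: (can_inj phiK); exact: (trivial_iso L Y).
- exfalso; apply: (nontrivial_iso L Y s) => // g h.
  by apply: (can_inj psiK); exact: (trivial_iso D X).
- exists id; last by move=> x y z Dx; case: nD; exists x.
  split => [x Dx|x y|y Ly] //=; first by case: nD; exists x.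
  by case: nL; exists y.
Qed.

End Assembly.

Theorem theorem5p2 (R : realType) (Delta Lambda : set R)
    (hDelta : distance_value_set Delta) (cDelta : countable Delta)
    (hLambda : distance_value_set Lambda) (cLambda : countable Lambda)
    (UDelta ULambda : metricType R)
    (hUDelta : urysohn_space Delta UDelta)
    (hULambda : urysohn_space Lambda ULambda) :
  (group_isomorphic (Iso UDelta) (Iso ULambda) <->
     Iso_topologically_isomorphic UDelta ULambda) /\
  (Iso_topologically_isomorphic UDelta ULambda <->
     equivalent_value_sets Delta Lambda).
Proof.
have h13 := @isomorphic_equivalent R Delta Lambda _ _ hDelta hLambda hUDelta hULambda.
have h32 := @equivalent_topologically_isomorphic R Delta Lambda _ _
  hDelta hLambda hUDelta hULambda.
have h21 : Iso_topologically_isomorphic UDelta ULambda ->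
    group_isomorphic (Iso UDelta) (Iso ULambda).
  by move=> [f [f' [fK f'K _ _]]]; exists f, f'.
by split; split; [move=> /h13/h32|exact: h21|move=> /h21/h13|exact: h32].
Qed.
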